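(* Let $X \subset \Sigma^{\mathbb{Z}^2}$ be a $\mathbb{Z}^2$-subshift with $X \neq \{0^{\mathbb{Z}^2}\}$ and let $L = \mathbb{R}\mathbf v$, $\mathbf v \in \mathbb{R}^2\setminus\{(0,0)\}$, be a line with arbitrary slope. Suppose that for some $r > 0$, for every $\mathbf u \in \mathbb{R}^2$ and every $x \in X$, the strip $\mathbf u + L + B_r(\mathbf 0)$ in $x$ contains only finitely many nonzero symbols. Then $X$ contains a nonzero finite point, a cluster fractal, or a highway in direction $\mathbf v^T$, where $\mathbf v^T$ denotes a vector orthogonal to $\mathbf v$ of the same length.
   Context: A $\mathbb{Z}^2$-subshift is a nonempty closed shift-invariant subset of $\Sigma^{\mathbb{Z}^2}$ (product topology), where $\sigma^{\mathbf v}(x)_{\mathbf u} = x_{\mathbf u + \mathbf v}$ and $\Sigma \ni 0$ is a finite alphabet; symbols other than $0$ are nonzero, and the support of a configuration is its set of nonzero cells. $B_r(\mathbf 0)$ is the closed ball of radius $r$ around the origin in $\mathbb{R}^2$. A finite point is a configuration with finite support. Highway in direction $\mathbf w\in\mathbb{R}^2\setminus\{\mathbf 0\}$: a configuration $x$ whose support is the range of a path $p : \mathbb{Z} \to \mathbb{Z}^2$ (consecutive steps of bounded size) such that the sequence $n \mapsto \langle p(n), \mathbf w\rangle$ is uniformly ascending, i.e. there is $m\in\mathbb{N}$ with $\langle p(j+m+1) - p(j), \mathbf w\rangle > 0$ for all $j$, and such that the colored path $i \mapsto (p(i), x_{p(i)})$ is uniformly recurrent, i.e. in the bi-infinite sequence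 $i \mapsto (p(i+1)-p(i), x_{p(i)})$ every finite subword that occurs does so with bounded gaps. Cluster fractals. On $\mathbb{Z}^d$ (here $d=2$) use $d(\mathbf u,\mathbf v) = \max_i |\mathbf u_i - \mathbf v_i|$, and let $B_r(S)$ be the set of cells at distance at most $r$ from $S$. A pattern is a function $P : D(P) \to \Sigma$ with $D(P) \subset \mathbb{Z}^d$; its support $S(P)$ is the set of cells of $D(P)$ where $P$ is nonzero. A set $S$ is $r$-connected if the graph on $S$ with edges between cells at distance at most $r$ is connected. $P$ is $r$-padded if $D(P) \supset B_r(S(P))$. An $r$-cluster is an $r$-padded pattern (with nonempty support) whose support is $r$-connected and all of whose zero cells are at distance at most $r$ from the support. $R$ is a zero-gluing of patterns $P$, $Q$ if $D(R) = D(P)\cup D(Q)$, $R|_{D(P)} = P$, $R|_{D(Q)} = Q$, and $P$, $Q$ are both $0$ on $D(P)\cap D(Q)$ (similarly for finitely many patterns). $P|_{\mathbb{Z}^d}$ is the configuration agreeing with $P$ on $D(P)$ and $0$ elsewhere. A configuration $x$ is a cluster fractal if it is not all-zero and there are $r_1 < r_2 < \cdots$ in $\mathbb{N}$ and, for each $i$, a finite set $B_i$ of finite $r_i$-clusters such that for all $i$: (1) each cluster in $B_{i+1}$ is obtained by zero-gluing translates of clusters in $B_i$ and adding the $r_{i+1}$-padding by zeroes; (2) each cluster in $B_{i+1}$ contains a translate of every cluster in $B_i$; (3) each cluster in $B_{i+1}$ contains at least two translates of clusters in $B_i$ with disjoint supports; and (4) $x = \lim_{j\to\infty} \sigma^{\mathbf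 v_j}(b_j|_{\mathbb{Z}^d})$ for some sequences $\mathbf v_j \in \mathbb{Z}^d$, $b_j \in B_j$. *)

(* Defs.v *)
From mathcomp Require Import all_boot all_order all_algebra.
From mathcomp Require Import all_classical all_reals all_analysis.
Import Order.TTheory GRing.Theory Num.Theory.
Import numFieldNormedType.Exports.

Set Implicit Arguments.
Unset Strict Implicit.
Unset Printing Implicit Defensive.

Local Open Scope classical_set_scope.
Local Open Scope ring_scope.

Definition cell : Type := (int * int)%type.

Definition cell_dist (u v : cell) : nat := maxn `|u.1 - v.1|%N `|u.2 - v.2|%N.

Definition fatten (r : nat) (A : set cell) : set cell :=
  [set u | exists2 a, A a & (cell_dist u a <= r)%N].

(* On a pattern, [translate v] moves the domain by [- v]. *)
Definition translate (T : Type) (v : cell) (f : cell -> T) : cell -> T :=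
  fun u => f (u + v).

(** Configurations and subshifts; the alphabet [S] has a marked symbol [z],
    playing the role of 0. *)

Definition config (S : finType) : Type :=
  prod_topology (fun _ : cell => discrete_topology S).

Definition zero_config (S : finType) (z : S) : config S := fun=> z.

Definition nonzero_cells (S : finType) (z : S) (x : config S) : set cell :=
  [set u | x u != z :> S].

Definition subshift (S : finType) (X : set (config S)) : Prop :=
  [/\ X !=set0, closed X
    & forall (v : cell) (x : config S), X x -> X (translate v x)].

Definition finite_point (S : finType) (z : S) (x : config S) : Prop :=
  finite_set (nonzero_cells z x).

(** The Euclidean plane. The library norm on [R * R] is the max norm, so the
    Euclidean one is spelled out. *)

Definition dot (R : realType) (u w : R * R) : R := u.1 * w.1 + u.2 * w.2.

Definition enorm (R : realType) (u : R * R) : R := Num.sqrt (dot u u).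

Definition cellR (R : realType) (c : cell) : R * R := (c.1%:~R, c.2%:~R).

(* u + R v + B_r(0) *)
Definition strip (R : realType) (v : R * R) (r : R) (u : R * R) :
    set (R * R) :=
  [set q | exists (t : R) (b : R * R),
     enorm b <= r /\ q = (u.1 + t * v.1 + b.1, u.2 + t * v.2 + b.2)].

Definition uniformly_recurrent (T : Type) (a : int -> T) : Prop :=
  forall (i : int) (n : nat), exists N : nat, forall j : int,
    exists2 k : nat, (k <= N)%N &
      forall t : nat, (t < n)%N -> a (j + k%:Z + t%:Z) = a (i + t%:Z).

Definition uniformly_ascending (R : realType) (f : int -> R) : Prop :=
  exists m : nat, forall j : int, f (j + m.+1%:Z) - f j > 0.

Definition highway (R : realType) (S : finType) (z : S) (w : R * R)
    (x : config S) : Prop :=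
  exists p : int -> cell,
    [/\ nonzero_cells z x = range p,
        exists M : nat, forall n, (cell_dist (p (n + 1)) (p n) <= M)%N,
        uniformly_ascending (fun n => dot (cellR R (p n)) w)
      & uniformly_recurrent (fun i => (p (i + 1) - p i, (x (p i) : S)))].

(** Patterns: [P u = None] means that [u] is outside the domain of [P]. *)

Definition pattern (S : finType) : Type := cell -> option S.

Definition pdom (S : finType) (P : pattern S) : set cell :=
  [set u | P u != None].

Definition psupport (S : finType) (z : S) (P : pattern S) : set cell :=
  [set u | exists2 a, P u = Some a & a != z].

(* [Q] is the restriction of [P] to the domain of [Q]. *)
Definition subpattern (S : finType) (Q P : pattern S) : Prop :=
  forall u, pdom Q u -> P u = Q u.

Definition extend (S : finType) (z : S) (P : pattern S) : config S :=
  fun u => odflt z (P u).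

Definition padding (S : finType) (z : S) (r : nat) (P : pattern S) :
    pattern S :=
  fun u => if P u is Some a then Some a
           else if u \in fatten r (psupport z P) then Some z else None.

Definition connected_at (r : nat) (A : set cell) : Prop :=
  forall u v, A u -> A v -> exists s : seq cell,
    [/\ path (fun a b => (cell_dist a b <= r)%N) u s, last u s = v
      & forall a, a \in s -> A a].

Definition padded (S : finType) (z : S) (r : nat) (P : pattern S) : Prop :=
  fatten r (psupport z P) `<=` pdom P.

Definition is_cluster (S : finType) (z : S) (r : nat) (P : pattern S) : Prop :=
  [/\ padded z r P, psupport z P !=set0, connected_at r (psupport z P)
    & forall u, P u = Some z -> fatten r (psupport z P) u].

Definition zero_gluing (S : finType) (z : S) (n : nat)
    (Q : 'I_n -> pattern S) (P : pattern S) : Prop :=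
  [/\ pdom P = \bigcup_(k in [set: 'I_n]) pdom (Q k),
      forall k, subpattern (Q k) P
    & forall k l, k != l -> forall u, pdom (Q k) u -> pdom (Q l) u ->
        Q k u = Some z /\ Q l u = Some z].

Definition cluster_fractal (S : finType) (z : S) (x : config S) : Prop :=
  x <> zero_config z /\
  exists (r : nat -> nat) (B : nat -> set (pattern S)),
    (forall i, (r i < r i.+1)%N) /\
    (forall i, finite_set (B i)) /\
    (forall i P, B i P -> finite_set (pdom P) /\ is_cluster z (r i) P) /\
    (forall i P, B i.+1 P ->
       exists (n : nat) (Q : 'I_n -> pattern S) (v : 'I_n -> cell)
              (G : pattern S),
         [/\ forall k, B i (Q k),
             zero_gluing z (fun k => translate (v k) (Q k)) G
           & P = padding z (r i.+1) G]) /\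
    (forall i P Q, B i.+1 P -> B i Q ->
       exists v : cell, subpattern (translate v Q) P) /\
    (forall i P, B i.+1 P ->
       exists (Q1 Q2 : pattern S) (v1 v2 : cell),
         [/\ B i Q1 /\ B i Q2,
             subpattern (translate v1 Q1) P, subpattern (translate v2 Q2) P
           & psupport z (translate v1 Q1) `&` psupport z (translate v2 Q2) = set0]) /\
    (exists (v : nat -> cell) (b : nat -> pattern S),
       (forall j, B j (b j)) /\
       (fun j => translate (v j) (extend z (b j)) : config S) @ \oo --> x).

(* Main.v *)
Require Import Defs.
From mathcomp Require Import all_boot all_order all_algebra.
From mathcomp Require Import all_classical all_reals all_analysis.
From mathcomp Require Import zify ring lra.
Import Order.TTheory GRing.Theory Num.Theory.

(** Inside the given subshift there is, by Zorn and compactness, a subshift [M]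
    which is minimal among the closed shift-invariant sets that contain a
    nonzero configuration ([minimal_subshift_exists]).  In [M] every finite
    pattern with a nonzero symbol at the origin reappears at bounded distance
    from every nonzero cell of every configuration ([syndetic]).  Suppose that
    [M] has no nonzero finite point, and for each [k] cut the support of a
    configuration into its [k]-connected components.

    - All components are finite, for every [k] and every configuration of [M].
      By compactness their size is bounded for each [k], and by [syndetic] the
      component of a nonzero cell at a much larger scale contains a copy of
      every component of the smaller scale.  Hence the components along a fast
      growing sequence of scales are the levels of a cluster fractal, whose
      limits include every configuration of [M] that is nonzero at the origin
      ([cluster_fractal_of_components]).

    - Some component is infinite, at a scale fixed from now on.  Let the height
      of a cell be its scalar product with [vT]; the hypothesis says that slabs
      of bounded height have finite support.  An infinite component therefore
      has unbounded height, so there are cells whose component reaches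
      arbitrarily far up and down: tall cells.  The heart of the proof is
      [tall_narrow]: the other nonzero cells at about the height of a tall cell
      are at bounded distance from it.  If they were not, any finite set [s]
      that is contained in one slab and in the support of some configuration
      could be enlarged by one more cell of the same slab
      ([realizable_extend]); iterating and passing to a limit would give a slab
      with infinite support.  For the enlargement, take a tall cell [c] and a
      far nonzero cell [c'] at the same height, and copies of [s] near both.
      If neither copy could be enlarged, each would be the whole support in
      its slab; but the component of [c] crosses both slabs, so a piece of it
      of bounded height would connect a cell near [c] to a cell near [c'],
      whereas linked pieces of bounded height have bounded diameter
      ([slab_bound]).

      A limit at taller and taller cells is a configuration of [M] in which
      every cell sees a bounded set at its own height and has neighbours a
      bounded amount above and below ([tight_exists]).  Listing its support in
      order of increasing height gives a highway ([tight_highway]): the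
      successor of a cell is determined by a bounded window, so [syndetic]
      makes the coloured path uniformly recurrent. *)

Set Implicit Arguments.
Unset Strict Implicit.
Unset Printing Implicit Defensive.
Local Open Scope classical_set_scope.
Local Open Scope ring_scope.

(** * Cells, windows and compactness *)

Definition cnorm (u : cell) : nat := cell_dist u 0.
Arguments cnorm u%_R.

Lemma cell_distC (u v : cell) : cell_dist u v = cell_dist v u.
Proof. by case: u v => [a b] [c d]; rewrite /cell_dist /=; lia. Qed.

Lemma cell_dist_triangle (w u v : cell) :
  (cell_dist u v <= cell_dist u w + cell_dist w v)%N.
Proof. by case: u v w => [a b] [c d] [e f]; rewrite /cell_dist /=; lia. Qed.

Lemma cell_distD2r (g u v : cell) : cell_dist (u + g) (v + g) = cell_dist u v.
Proof. by case: u v g => [a b] [c d] [e f]; rewrite /cell_dist /=; lia. Qed.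

Lemma cnormB (u v : cell) : cnorm (u - v) = cell_dist u v.
Proof. by case: u v => [a b] [c d]; rewrite /cnorm /cell_dist /=; lia. Qed.

Lemma cnormN (u : cell) : cnorm (- u) = cnorm u.
Proof. by case: u => [a b]; rewrite /cnorm /cell_dist /=; lia. Qed.

Lemma cnormD (u v : cell) : (cnorm (u + v) <= cnorm u + cnorm v)%N.
Proof. by case: u v => [a b] [c d]; rewrite /cnorm /cell_dist /=; lia. Qed.

Lemma cnorm0 : cnorm 0 = 0%N.
Proof. by rewrite /cnorm /cell_dist /=; lia. Qed.

Lemma cell_distxx (u : cell) : cell_dist u u = 0%N.
Proof. by case: u => [a b]; rewrite /cell_dist /=; lia. Qed.

Definition cells_within (m : nat) : seq cell :=
  [seq ((i : nat)%:Z - m%:Z, (j : nat)%:Z - m%:Z)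
     | i <- iota 0 (2 * m).+1, j <- iota 0 (2 * m).+1].

Arguments cells_within : simpl never.

Lemma mem_cells_within (m : nat) (u : cell) :
  (u \in cells_within m) = (cnorm u <= m)%N.
Proof.
have H (i j : nat) : (i < 0 + (2 * m).+1)%N -> (j < 0 + (2 * m).+1)%N ->
    (cnorm (i%:Z - m%:Z, j%:Z - m%:Z)%R <= m)%N.
  by rewrite /cnorm /cell_dist /=; lia.
apply/idP/idP.
  by case/allpairsP=> -[i j] [] /[!mem_iota] /= hi hj ->; exact: H.
case: u => [a b] h; apply/allpairsP.
have [ha hb] : (`|(a + m%:Z)%R| < 0 + (2 * m).+1)%N /\
    (`|(b + m%:Z)%R| < 0 + (2 * m).+1)%N.
  by move: h; rewrite /cnorm /cell_dist /=; lia.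
exists (`|(a + m%:Z)%R|%N, `|(b + m%:Z)%R|%N); rewrite !mem_iota; split=> //=.
by move: h; rewrite /cnorm /cell_dist /= => h; congr pair; lia.
Qed.

Section Configurations.
Variables (S : finType).
Implicit Types (x y : config S) (X : set (config S)).

Definition agree (m : nat) x y : Prop :=
  forall u, (cnorm u <= m)%N -> x u = y u.

Lemma agree_le m n x y : (m <= n)%N -> agree n x y -> agree m x y.
Proof. by move=> mn h u um; apply: h; exact: leq_trans mn. Qed.

Lemma agree_sym m x y : agree m x y -> agree m y x.
Proof. by move=> h u um; rewrite h. Qed.

Lemma nbhs_coord x (u : cell) : nbhs x [set y | y u = x u].
Proof.
have := @proj_continuous cell (fun=> discrete_topology S) u x [set x u].
by apply; exact: discrete_set1.
Qed.

Lemma nbhs_agree_win x m : nbhs x [set y | agree m x y].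
Proof.
have FF : Filter (nbhs x) by exact: nbhs_filter.
have H (s : seq cell) : nbhs x [set y | forall u, u \in s -> x u = y u].
  elim: s => [|u s IH]; first by apply: filterE => y u; rewrite in_nil.
  apply: filterS (filterI (nbhs_coord x u) IH) => y /= [xu hs] w.
  by rewrite inE => /orP[/eqP ->|/hs].
by apply: filterS (H (cells_within m)) => y hy u um; apply: hy; rewrite mem_cells_within.
Qed.

(** The windows form a basis of neighbourhoods: all topology below goes through
    this fact, so that closedness and limits become statements on windows. *)
Lemma nbhs_agree x (U : set (config S)) :
  nbhs x U <-> exists m, [set y | agree m x y] `<=` U.
Proof.
split; last by case=> m mU; apply: filterS (nbhs_agree_win x m).
move=> xU.
pose G : set_system (config S) :=
  filter_from [set: nat] (fun m => [set y | agree m x y]).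
have FG : Filter G.
  apply: filter_from_filter; first by exists 0%N.
  move=> m n _ _; exists (maxn m n) => // y hy; split => //=.
    by apply: agree_le hy; rewrite leq_maxl.
  by apply: agree_le hy; rewrite leq_maxr.
have : G --> x.
  apply/cvg_sup => u V [W [[A] oA <-] Au] WV.
  exists (cnorm u) => // y hy; apply: WV => /=.
  by rewrite /= -(hy u).
by move=> /(_ U xU) [m _ mU]; exists m.
Qed.

Lemma config_compact : compact [set: config S].
Proof.
have := @tychonoff cell (fun=> discrete_topology S) (fun=> setT) _.
rewrite (_ : [set f | _] = setT); last by rewrite predeqE.
by apply => _; apply: finite_compact; exact: finite_finset.
Qed.

Lemma closed_agree X x : closed X ->
  (forall m, exists2 y : config S, X y & agree m x y) -> X x.
Proof.
move=> cX h; apply: cX => U /nbhs_agree[m mU].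
by have [y Xy xy] := h m; exists y; split => //; exact: mU.
Qed.

Lemma agree_closed X :
  (forall x, (forall m, exists2 y : config S, X y & agree m x y) -> X x) ->
  closed X.
Proof.
move=> h x cx; apply: h => m.
by have [y [Xy xy]] := cx _ (nbhs_agree_win x m); exists y.
Qed.

(** Compactness as it is used throughout: a bound that exists for each
    configuration and still holds for all configurations of [X] that agree with
    it on a window is uniform.  Applied to the negation of a decreasing sequence
    of closed conditions, it also yields a configuration that satisfies all of
    them. *)
Lemma compact_bound X (P : nat -> config S -> Prop) : closed X ->
  (forall n m x, (n <= m)%N -> P n x -> P m x) ->
  (forall x, X x -> exists n m, forall y, X y -> agree m x y -> P n y) ->
  exists n, forall x, X x -> P n x.
Proof.
move=> cX mono loc.
have kX : compact X := subclosed_compact cX config_compact (@subsetT _ _).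
have /near_covering_withinP/(_ nat \oo P) := (compact_near_coveringP _).1 kX.
case=> [x Xx|n _ nP]; last by exists n => x; apply: (nP n) => /=.
have [n [m nm]] := loc x Xx.
exists ([set y | agree m x y], [set k | (n <= k)%N]) => /=.
  by split; [exact: nbhs_agree_win | exists n].
move=> [y k] [/= xy nk] Xy; apply: mono nk _; exact: nm.
Qed.

End Configurations.

(** * Minimal nonzero subshifts *)

Section Minimal.
Variables (S : finType) (z : S).
Implicit Types (x y : config S) (X M : set (config S)).

(** By shift invariance, the condition at the origin says that some
    configuration is nonzero; in this form it is clopen and survives in limits,
    which makes Zorn's lemma applicable. *)
Definition nonzero_subshift X : Prop :=
  [/\ closed X, forall (v : cell) x, X x -> X (translate v x)
    & exists2 x : config S, X x & x 0 != z].

Definition minimal_subshift M : Prop :=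
  nonzero_subshift M /\
  forall M', M' `<=` M -> nonzero_subshift M' -> M `<=` M'.

Lemma translateD x (g h : cell) :
  translate g (translate h x) = translate (g + h) x.
Proof. by apply/funext => u; rewrite /translate addrA. Qed.

Lemma agree_translate m x y (g : cell) :
  agree (m + cnorm g) x y -> agree m (translate g x) (translate g y).
Proof.
move=> h u um; apply: h; apply: leq_trans (cnormD _ _) _.
by rewrite leq_add2r.
Qed.

(** The sets of configurations of the members of the chain which are nonzero at
    the origin generate a proper filter; any cluster point of it is in the
    intersection. *)
Lemma nonzero_subshift_bigcap (F : set (set (config S))) :
  F !=set0 -> total_on F subset -> (forall Y, F Y -> nonzero_subshift Y) ->
  nonzero_subshift (\bigcap_(Y in F) Y).
Proof.
move=> [Y0 FY0] totF hF; split.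
- by apply: closed_bigI => Y /hF[].
- by move=> v x hx Y FY; have [_ inv _] := hF Y FY; apply: inv; exact: hx.
pose G : set_system (config S) :=
  filter_from F (fun Y => [set y | Y y /\ y 0 != z :> S]).
have PG : ProperFilter G.
  apply: filter_from_proper; last first.
    by move=> Y /hF[_ _ [y Yy y0]]; exists y.
  apply: filter_from_filter; first by exists Y0.
  move=> Y Y' FY FY'; have [le|le] := totF Y Y' FY FY'.
    by exists Y => // y [Yy y0]; split; split => //; exact: le.
  by exists Y' => // y [Yy y0]; split; split => //; exact: le.
have [p [_ cp]] := config_compact PG filterT.
have key Y m : F Y -> exists y : config S, [/\ Y y, y 0 != z & agree m p y].
  move=> FY; have GY : G [set y | Y y /\ y 0 != z :> S] by exists Y.
  by have [y [[Yy y0] py]] := cp _ _ GY (nbhs_agree_win p m); exists y.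
exists p.
  move=> Y FY; have [cY _ _] := hF Y FY; apply: (closed_agree cY) => m.
  by have [y [Yy _ py]] := key Y m FY; exists y.
have [y [_ y0 py]] := key Y0 0%N FY0.
by rewrite (py 0) // cnorm0.
Qed.

Lemma minimal_subshift_exists X : nonzero_subshift X ->
  exists2 M, M `<=` X & minimal_subshift M.
Proof.
move=> nX.
(* Zorn applied to the complements in X, which turns intersections into unions *)
have [|A [nA maxA]] :=
    @Zorn_bigcup (config S) (fun A => nonzero_subshift (X `\` A)).
  move=> F hF totF; have [->|/set0P F0] := eqVneq F set0.
    by rewrite bigcup_set0 setD0.
  rewrite (_ : X `\` _ = \bigcap_(Y in [set X `\` A | A in F]) Y).
    apply: nonzero_subshift_bigcap.
    - by have [A FA] := F0; exists (X `\` A), A.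
    - move=> _ _ [A FA <-] [B FB <-]; have [le|le] := totF A B FA FB.
        by right; exact: setDS.
      by left; exact: setDS.
    - by move=> _ [A FA <-]; exact: hF.
  rewrite bigcap_image predeqE => x; split.
    move=> [Xx nx] A FA; split => // Ax; apply: nx; by exists A.
  have [B FB] := F0.
  move=> h; split; first by have [] := h B FB.
  by case=> A FA Ax; have [_] := h A FA.
exists (X `\` A) => [x []//|]; split=> // M' sM' nM' x Mx.
apply: contrapT => nx; apply: (maxA (~` M')).
  split; last first.
    move=> /(_ x nx) Ax; by case: Mx.
  by move=> y Ay /sM' [].
rewrite (_ : X `\` _ = M') // predeqE => y; split.
  by move=> [_ /contrapT].
by move=> M'y; split; [have [] := sM' _ M'y | move=> /(_ M'y)].
Qed.

(** The configurations of [M] none of whose shifts agrees with [y] on the window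
    form a closed invariant set that misses [y]; by minimality it contains no
    configuration which is nonzero at the origin. *)
Lemma minimal_visits M m x y : minimal_subshift M -> M x -> M y ->
  x 0 != z -> y 0 != z -> exists g : cell, agree m (translate g x) y.
Proof.
move=> [[cM invM _] minM] Mx My x0 y0; apply: contrapT => nog.
pose M' : set (config S) :=
  [set w | M w /\ forall g : cell, ~ agree m (translate g w) y].
have : M `<=` M'.
  apply: minM => [w []//|]; split; last first.
  - by exists x => //; split => // g hg; apply: nog; exists g.
  - move=> v w [Mw hw]; split; first exact: invM.
    by move=> g; rewrite translateD; exact: hw.
  apply: agree_closed => w hw; split.
    by apply: (closed_agree cM) => k; have [u [Mu _] wu] := hw k; exists u.
  move=> g hg; have [u [_ hu] wu] := hw (m + cnorm g)%N.
  by apply: (hu g) => c cm; rewrite -(hg c cm) (agree_translate wu).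
move=> /(_ _ My)[_ /(_ 0)]; apply => u _.
by rewrite /translate addr0.
Qed.

(** Every pattern around a nonzero cell recurs at bounded distance from every
    nonzero cell.  This is the only way in which minimality is used in the two
    constructions below. *)
Lemma syndetic M m : minimal_subshift M -> exists N, forall x y, M x -> M y ->
  x 0 != z -> y 0 != z ->
  exists2 g : cell, (cnorm g <= N)%N & agree m (translate g x) y.
Proof.
move=> mM; have [[cM _ _] _] := mM.
pose P (y : config S) (N : nat) (x : config S) := x 0 != z -> y 0 != z ->
  exists2 g : cell, (cnorm g <= N)%N & agree m (translate g x) y.
have Pmono y n k x : (n <= k)%N -> P y n x -> P y k x.
  move=> nk h x0 y0; have [g gn hg] := h x0 y0.
  by exists g => //; exact: leq_trans nk.
have stepx y : M y -> exists N, forall x, M x -> P y N x.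
  move=> My; apply: (compact_bound cM) => [n k x|x Mx]; first exact: Pmono.
  have [x0|x0] := eqVneq (x 0) z.
    exists 0%N, 0%N => w _ xw w0 y0; exfalso.
    by move: w0; rewrite -(xw 0) ?cnorm0// x0 eqxx.
  have [y0|y0] := eqVneq (y 0) z.
    by exists 0%N, 0%N => w _ xw w0 y0'; exfalso; move: y0'; rewrite y0 eqxx.
  have [g hg] := minimal_visits m mM Mx My x0 y0.
  exists (cnorm g), (m + cnorm g)%N => w _ xw _ _; exists g => // u um.
  by rewrite -(hg u um) (agree_translate xw).
have [|y My|N hN] := compact_bound cM
    (P := fun N y => forall x, M x -> P y N x).
- by move=> n k y nk h x Mx; apply: Pmono nk _; exact: h.
- have [N hN] := stepx y My; exists N, m => w Mw yw x Mx x0 w0.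
  have y0 : y 0 != z by rewrite (yw 0) ?cnorm0.
  have [g gN hg] := hN x Mx x0 y0; exists g => // u um.
  by rewrite hg // yw.
exists N => x y Mx My x0 y0; exact: (hN y My x Mx x0 y0).
Qed.

End Minimal.

(** * Linked cells *)

Lemma finite_set_bounded (A : set cell) :
  finite_set A <-> exists m, forall u, A u -> (cnorm u <= m)%N.
Proof.
split.
  move=> /finite_seqP[s ->]; exists (\max_(u <- s) cnorm u)%N => u /= us.
  exact: (@leq_bigmax_seq _ s xpredT cnorm).
move=> [m hm]; apply: sub_finite_set _ (finite_seq (cells_within m)) => u /hm um /=.
by rewrite mem_cells_within.
Qed.

(** The inductive form of the paths in [connected_at], suited to inductions along
    the path; both end points are required to be in [A]. *)
Inductive linked (r : nat) (A : set cell) : cell -> cell -> Prop :=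
| linked0 u of A u : linked r A u u
| linkedS u w v of A u & (cell_dist u w <= r)%N & linked r A w v :
    linked r A u v.

Section Linked.
Variables (r : nat) (A : set cell).

Lemma linked_src u v : linked r A u v -> A u.
Proof. by case. Qed.

Lemma linked_tgt u v : linked r A u v -> A v.
Proof. by elim. Qed.

Lemma linked_trans v u w : linked r A u v -> linked r A v w -> linked r A u w.
Proof. by elim=> // a b c Aa ab _ IH /IH; exact: linkedS. Qed.

Lemma linked_step u v : A u -> A v -> (cell_dist u v <= r)%N -> linked r A u v.
Proof. by move=> Au Av uv; apply: linkedS uv _ => //; exact: linked0. Qed.

Lemma linked_sym u v : linked r A u v -> linked r A v u.
Proof.
elim=> [a Aa|a b c Aa ab l IH]; first exact: linked0.
apply: linked_trans IH _; apply: linked_step => //; first exact: linked_src l.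
by rewrite cell_distC.
Qed.

Lemma linked_connected u : connected_at r [set v | linked r A u v].
Proof.
move=> a b ua ub.
have : linked r A a b by apply: linked_trans ub; exact: linked_sym.
move=> ab; elim: ab ua => {a b ub} [a Aa|a b c Aa ab l IH] ua.
  by exists [::].
have ub : linked r A u b.
  by apply: linked_trans ua _; apply: linked_step => //; exact: linked_src l.
have [s [ps ls hs]] := IH ub; exists (b :: s); split => //=; first by rewrite ab.
by move=> d; rewrite inE => /orP[/eqP ->//|/hs].
Qed.

End Linked.

Lemma linked_map r r' (A B : set cell) (g u v : cell) : (r <= r')%N ->
  (forall w, A w -> B (w + g)) -> linked r A u v ->
  linked r' B (u + g) (v + g).
Proof.
move=> rr' AB; elim=> [a /AB|a b c /AB Ba ab _]; first exact: linked0.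
by apply: linkedS => //; rewrite cell_distD2r (leq_trans ab).
Qed.

Lemma linked_sub r r' (A B : set cell) u v : (r <= r')%N -> A `<=` B ->
  linked r A u v -> linked r' B u v.
Proof.
move=> rr' AB l; rewrite -[u]addr0 -[v]addr0; apply: linked_map rr' _ l.
by move=> w /AB; rewrite addr0.
Qed.

Section UniformBound.
Variables (S : finType) (z : S).
Implicit Types (x y : config S) (M : set (config S)).

(** A linked set contained in a ball is determined by a window that exceeds the
    ball by [r]: a path of [y] cannot leave the linked set of [x], because its
    first cell outside would still be in the window. *)
Lemma linked_agree (I : set cell) (r m : nat) x y v :
  (forall w, linked r (nonzero_cells z x `&` I) 0 w -> (cnorm w <= m)%N) ->
  agree (m + r) x y -> linked r (nonzero_cells z y `&` I) 0 v ->
  linked r (nonzero_cells z x `&` I) 0 v.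
Proof.
move=> hm xy l0v.
have grow u w : linked r (nonzero_cells z y `&` I) u w ->
    linked r (nonzero_cells z x `&` I) 0 u ->
    linked r (nonzero_cells z x `&` I) 0 w.
  elim=> // a b c _ ab l IH l0a; apply: IH.
  have [b0 Ib] := linked_src l.
  apply: (linked_trans l0a); apply: (linked_step _ _ ab).
    exact: linked_tgt l0a.
  split => //; rewrite /nonzero_cells /= xy //.
  have := hm a l0a; rewrite -(cnormB a b) in ab => am.
  rewrite (_ : b = a - (a - b)); last by rewrite opprB addrCA subrr addr0.
  by apply: leq_trans (cnormD _ _) _; rewrite cnormN leq_add.
apply: (grow _ _ l0v); apply: linked0.
have [y0 I0] := linked_src l0v.
by split => //; rewrite /nonzero_cells /= xy // cnorm0.
Qed.

(** The region [I] is everything for the components, and a slab of bounded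
    height for the pieces of components. *)
Lemma linked_uniform_bound M (I : set cell) (r : nat) : closed M ->
  (forall x, M x -> exists m, forall v,
     linked r (nonzero_cells z x `&` I) 0 v -> (cnorm v <= m)%N) ->
  exists m, forall x, M x -> forall v,
     linked r (nonzero_cells z x `&` I) 0 v -> (cnorm v <= m)%N.
Proof.
move=> cM hM; apply: (compact_bound cM) => [n k x nk h v /h vn|x Mx].
  exact: leq_trans nk.
have [m hm] := hM x Mx; exists m, (m + r)%N => y _ xy v l0v.
exact: (hm _ (linked_agree hm xy l0v)).
Qed.

End UniformBound.

(** * Components and clusters *)

Section Clusters.
Variables (S : finType) (z : S).
Implicit Types (x y : config S) (M : set (config S)) (P : pattern S).

Definition component (r : nat) x (c : cell) : set cell :=
  [set v | linked r (nonzero_cells z x) c v].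

(** The component of [c] with its [r]-padding: within distance [r] of the
    component, the other cells are automatically zero. *)
Definition cluster_at (r : nat) x (c : cell) : pattern S :=
  fun u => if u \in fatten r (component r x c) then Some (x u) else None.

Lemma sub_fatten r (A : set cell) : A `<=` fatten r A.
Proof. by move=> u Au; exists u => //; rewrite cell_distxx. Qed.

Lemma fattenS r r' (A B : set cell) : (r <= r')%N -> A `<=` B ->
  fatten r A `<=` fatten r' B.
Proof.
by move=> rr' AB u [a /AB Ba ua]; exists a => //; exact: leq_trans rr'.
Qed.

Lemma component_sub r r' x c : (r <= r')%N ->
  component r x c `<=` component r' x c.
Proof. by move=> rr' v; exact: linked_sub. Qed.

Lemma component_nonzero r x c v : component r x c v -> x v != z.
Proof. exact: linked_tgt. Qed.

Lemma component_trans r x c d v :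
  component r x c d -> component r x d v -> component r x c v.
Proof. exact: linked_trans. Qed.

Lemma component_sym r x c d : component r x c d -> component r x d c.
Proof. exact: linked_sym. Qed.

Lemma component_refl r x c : x c != z -> component r x c c.
Proof. exact: linked0. Qed.

Lemma fatten_component r x c u : x u != z ->
  fatten r (component r x c) u -> component r x c u.
Proof.
move=> xu [a ca ua]; apply: (linked_trans ca); apply: linked_step => //.
  exact: linked_tgt ca.
by rewrite cell_distC.
Qed.

Lemma component_translate r x (g c v : cell) :
  component r (translate g x) c v <-> component r x (c + g) (v + g).
Proof.
split; first by apply: linked_map.
move=> /(@linked_map _ r _ (nonzero_cells z (translate g x)) (- g)).
rewrite !addrK; apply => // w.
by rewrite /nonzero_cells /= /translate subrK.
Qed.

Lemma cluster_some r x c u a : cluster_at r x c u = Some a <->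
  fatten r (component r x c) u /\ a = x u.
Proof.
rewrite /cluster_at; case: ifPn => [/set_mem h|/negP h]; first by split=> [[<-]|[_ ->]].
by split=> // -[/mem_set].
Qed.

Lemma pdom_cluster r x c : pdom (cluster_at r x c) = fatten r (component r x c).
Proof.
apply/seteqP; split=> u; rewrite /pdom /= /cluster_at; first by case: ifPn => // /set_mem.
by move=> /mem_set ->.
Qed.

Lemma psupport_cluster r x c : psupport z (cluster_at r x c) = component r x c.
Proof.
apply/seteqP; split=> u.
  by case=> a /cluster_some[fu ->] xu; exact: fatten_component.
move=> cu; exists (x u); last exact: component_nonzero cu.
by apply/cluster_some; split => //; exact: sub_fatten.
Qed.

Lemma cluster_is_cluster r x c : x c != z -> is_cluster z r (cluster_at r x c).
Proof.
move=> xc; split.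
- by rewrite /padded psupport_cluster pdom_cluster.
- by rewrite psupport_cluster; exists c; exact: component_refl.
- by rewrite psupport_cluster; exact: linked_connected.
- by move=> u /cluster_some[fu _]; rewrite psupport_cluster.
Qed.

Lemma cluster_translate r x (g : cell) :
  translate (- g) (cluster_at r (translate g x) 0) = cluster_at r x g.
Proof.
apply/funext => u; rewrite /translate /cluster_at.
rewrite (_ : (u - g \in _) = (u \in fatten r (component r x g))).
  by rewrite subrK.
apply/idP/idP => /set_mem[a ca ua]; apply/mem_set.
  exists (a + g); last by rewrite -(subrK g u) cell_distD2r.
  by move/component_translate : ca; rewrite add0r.
exists (a - g); last by rewrite cell_distD2r.
by apply/component_translate; rewrite add0r subrK.
Qed.

(** A cluster is a local datum, so [syndetic] applies to it. *)
Lemma cluster_agree r m x y :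
  (forall v, component r x 0 v -> (cnorm v <= m)%N) ->
  (forall v, component r y 0 v -> (cnorm v <= m)%N) ->
  agree (m + r) x y -> cluster_at r x 0 = cluster_at r y 0.
Proof.
move=> hx hy xy.
have sub (a b : config S) : (forall v, component r a 0 v -> (cnorm v <= m)%N) ->
    agree (m + r) a b -> component r b 0 `<=` component r a 0.
  move=> ha ab v; have := @linked_agree S z setT r m a b v.
  by rewrite !setIT; apply.
have E : component r x 0 = component r y 0.
  by apply/seteqP; split; apply: sub => //; exact: agree_sym.
apply/funext => u; rewrite /cluster_at E; case: ifPn => // /set_mem[a ca ua].
congr Some; apply: xy; rewrite -(subrK a u) addrC.
by apply: leq_trans (cnormD _ _) _; rewrite leq_add ?hy// cnormB.
Qed.

Lemma cluster_subpattern r r' x (g : cell) : (r <= r')%N ->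
  component r' x 0 g -> subpattern (cluster_at r x g) (cluster_at r' x 0).
Proof.
move=> rr' cg u; rewrite pdom_cluster => fu.
have -> : cluster_at r x g u = Some (x u) by apply/cluster_some.
apply/cluster_some; split => //; apply: fattenS fu => // v cv.
by apply: (component_trans cg); exact: component_sub cv.
Qed.

Lemma component_eq r x c d :
  component r x c d -> component r x c = component r x d.
Proof.
move=> cd; apply/seteqP; split=> v; last exact: component_trans cd.
by apply: component_trans; exact: component_sym.
Qed.

(** A component of scale [r'] is the disjoint union of components of scale [r];
    paddings of distinct ones overlap only in zeros, since a nonzero cell of the
    overlap would belong to both components. *)
Lemma cluster_gluing r r' m x : (r <= r')%N -> x 0 != z ->
  (forall v, component r' x 0 v -> (cnorm v <= m)%N) ->
  exists (n : nat) (c : 'I_n -> cell) (G : pattern S),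
    [/\ forall k, x (c k) != z,
        zero_gluing z (fun k => cluster_at r x (c k)) G
      & cluster_at r' x 0 = padding z r' G].
Proof.
move=> rr' x0 hm.
(* depends on the component only, so its values list each component once *)
pose rep c := xget c (component r x c).
have repP c : x c != z -> component r x c (rep c).
  by move=> xc; apply: xgetPex; exists c; exact: component_refl.
have rep_eq c d : component r x c d -> rep c = rep d.
  move=> cd; rewrite /rep (component_eq cd).
  rewrite /xget; case: pselect => // -[]; exists d.
  by apply/asboolP; apply: component_refl; exact: component_nonzero cd.
pose l := undup [seq rep c | c <- cells_within m & `[< component r' x 0 c >]].
have lP d : d \in l -> component r' x 0 d /\ rep d = d.
  rewrite mem_undup => /mapP[c]; rewrite mem_filter => /andP[/asboolP c0 _] ->.
  have xc := component_nonzero c0; have rc := repP c xc; split.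
    by apply: (component_trans c0); exact: component_sub rc.
  by rewrite -(rep_eq _ _ rc).
pose c (k : 'I_(size l)) := nth 0 l k.
have cl k : c k \in l by rewrite mem_nth.
pose G : pattern S :=
  fun u => if u \in fatten r (component r' x 0) then Some (x u) else None.
have Gsome u a : G u = Some a <-> fatten r (component r' x 0) u /\ a = x u.
  rewrite /G; case: ifPn => [/set_mem h|/negP h]; first by split=> [[<-]|[_ ->]].
  by split=> // -[/mem_set].
have domG : pdom G = fatten r (component r' x 0).
  apply/seteqP; split=> u; rewrite /pdom /= /G; first by case: ifPn => // /set_mem.
  by move=> /mem_set ->.
have sub k : component r x (c k) `<=` component r' x 0.
  move=> v cv; have [ck _] := lP _ (cl k).
  by apply: (component_trans ck); exact: component_sub cv.
exists (size l), c, G; split.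
- by move=> k; have [/component_nonzero] := lP _ (cl k).
- split.
  + rewrite domG; apply/seteqP; split=> u.
      move=> [a ca ua].
      have xa := component_nonzero ca.
      have rl : rep a \in l.
        rewrite mem_undup map_f // mem_filter mem_cells_within hm // andbT.
        exact/asboolP.
      have lt : (index (rep a) l < size l)%N by rewrite index_mem.
      exists (Ordinal lt) => //; rewrite pdom_cluster /c /= nth_index //.
      by exists a => //; apply: component_sym; exact: repP.
    move=> [k _]; rewrite pdom_cluster; exact: fattenS.
  + move=> k u; rewrite pdom_cluster => fu.
    have -> : cluster_at r x (c k) u = Some (x u) by apply/cluster_some.
    by apply/Gsome; split => //; exact: fattenS fu.
  + move=> k k' kk' u; rewrite !pdom_cluster => fu fu'.
    have xu : x u = z.
      apply/eqP; apply: contraNT kk' => xu.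
      have cu := fatten_component xu fu; have cu' := fatten_component xu fu'.
      have [_ rk] := lP _ (cl k); have [_ rk'] := lP _ (cl k').
      have : c k = c k' by rewrite -rk -rk' (rep_eq _ _ cu) (rep_eq _ _ cu').
      by move/eqP; rewrite /c nth_uniq ?undup_uniq.
    by split; apply/cluster_some; rewrite xu.
- have suppG : psupport z G = component r' x 0.
    apply/seteqP; split=> u.
      case=> a /Gsome[fu ->] xu; apply: fatten_component => //.
      exact: fattenS fu.
    move=> cu; exists (x u); last exact: component_nonzero cu.
    by apply/Gsome; split => //; exact: sub_fatten.
  apply/funext => u; rewrite /padding suppG /cluster_at /G.
  case: (boolP (u \in fatten r _)) => [/set_mem fu|/negP nfu].
    by rewrite ifT //; apply/mem_set; exact: fattenS fu.
  case: ifPn => // /set_mem fu; congr Some; apply/eqP.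
  apply: contra_notT nfu => xu; apply/mem_set/sub_fatten.
  exact: fatten_component xu fu.
Qed.

End Clusters.

(** * Cluster fractals *)

Lemma finite_set_patterns (S : finType) (m : nat) (B : set (pattern S)) :
  (forall P, B P -> forall u, pdom P u -> (cnorm u <= m)%N) -> finite_set B.
Proof.
move=> hB.
pose f (t : (size (cells_within m)).-tuple (option S)) : pattern S :=
  fun u => nth None t (index u (cells_within m)).
apply: (@sub_finite_set _ _ (range f)); last first.
  by apply: finite_image; exact: finite_finset.
move=> P BP; exists (map_tuple (P : cell -> option S) (in_tuple (cells_within m))) => //.
apply/funext => u.
change (nth None (map (P : cell -> option S) (cells_within m))
  (index u (cells_within m)) = P u).
have [um|um] := boolP (u \in cells_within m).
  by rewrite (@nth_map cell 0 _ None) ?index_mem ?nth_index.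
rewrite nth_default; last by rewrite size_map memNindex.
apply/eqP; apply: contraNT um; rewrite eq_sym mem_cells_within; exact: hB.
Qed.

Section Fractal.
Variables (S : finType) (z : S) (M : set (config S)).
Hypothesis minM : minimal_subshift z M.
Hypothesis infM : forall x, M x -> x 0 != z -> ~ finite_set (nonzero_cells z x).
Hypothesis compM : forall r x, M x -> finite_set (component z r x 0).

Lemma component_uniform_bound r : exists m, forall x, M x -> forall v,
  component z r x 0 v -> (cnorm v <= m)%N.
Proof.
have [[cM _ _] _] := minM.
have [|m hm] := @linked_uniform_bound S z M setT r cM.
  by move=> x Mx; rewrite setIT; apply/finite_set_bounded; exact: compM.
by exists m => x Mx v; have := hm x Mx v; rewrite setIT.
Qed.

Lemma far_nonzero_cell m : exists N, forall x, M x -> x 0 != z ->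
  exists g : cell, [/\ (m < cnorm g)%N, (cnorm g <= N)%N & x g != z].
Proof.
have [[cM _ _] _] := minM.
apply: (compact_bound cM) => [n k x nk h x0|x Mx].
  have [g [mg gn xg]] := h x0; exists g; split => //; exact: leq_trans nk.
have [x0|x0] := eqVneq (x 0) z.
  exists 0%N, 0%N => y _ xy y0; exfalso.
  by move: y0; rewrite -(xy 0) ?cnorm0// x0 eqxx.
have [g mg xg] : exists2 g : cell, (m < cnorm g)%N & x g != z.
  apply: contrapT => no; apply: (infM Mx x0); apply/finite_set_bounded.
  exists m => u xu; rewrite leqNgt; apply/negP => mu; apply: no; by exists u.
by exists (cnorm g), (cnorm g) => y _ xy _; exists g; rewrite -xy.
Qed.

(** For a cluster fractal one needs scales at which each component contains a
    copy of every smaller cluster, and two of them with disjoint supports.  The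
    origin is linked in a single step to any nonzero cell within distance [r'],
    so it suffices to take [r'] beyond two bounds: the one of [syndetic], and
    the distance from a nonzero cell to a nonzero cell outside its own
    component. *)
Lemma next_scale r : exists r', [/\ (r < r')%N,
  forall x y, M x -> M y -> x 0 != z -> y 0 != z -> exists2 g : cell,
    component z r' x 0 g & cluster_at z r (translate g x) 0 = cluster_at z r y 0
  & forall x, M x -> x 0 != z -> exists2 g : cell,
    component z r' x 0 g & ~ component z r x 0 g].
Proof.
have [[cM invM _] _] := minM.
have [m hm] := component_uniform_bound r.
have [N hN] := syndetic (m + r)%N minM.
have [K hK] := far_nonzero_cell m.
exists (maxn r.+1 (maxn N K)); split.
- by rewrite leq_max ltnSn.
- move=> x y Mx My x0 y0; have [g gN hg] := hN x y Mx My x0 y0; exists g.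
    apply: linked_step => //.
      by rewrite /nonzero_cells /= -[g]add0r [_ != _](_ : _ = (y 0 != z)) // -hg ?cnorm0.
    by rewrite cell_distC -cnormB subr0 !leq_max gN orbT.
  apply: (@cluster_agree S z r m) => //.
    exact/hm/invM.
  exact: hm.
- move=> x Mx x0; have [g [mg gK xg]] := hK x Mx x0; exists g.
    apply: linked_step => //.
    by rewrite cell_distC -cnormB subr0 !leq_max gK !orbT.
  by move=> /(hm x Mx); rewrite leqNgt mg.
Qed.

Lemma cluster_fractal_of_components x : M x -> x 0 != z -> cluster_fractal z x.
Proof.
move=> Mx x0.
have [[cM invM _] _] := minM.
split; first by move=> xz; move: x0; rewrite xz eqxx.
have [F hF] := choice next_scale.
pose r n := iter n F 0%N.
have rlt i : (r i < r i.+1)%N by have [] := hF (r i).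
have rge i : (i <= r i)%N by elim: i => // i IH; exact: leq_ltn_trans (rlt i).
(* translates need not be listed: it is enough to see each cluster from the origin *)
pose B i : set (pattern S) :=
  [set P | exists y : config S, [/\ M y, y 0 != z & P = cluster_at z (r i) y 0]].
have bound i : exists m, forall P, B i P -> forall u, pdom P u -> (cnorm u <= m)%N.
  have [m hm] := component_uniform_bound (r i); exists (m + r i)%N.
  move=> _ [y [My y0 ->]] u; rewrite pdom_cluster => -[a ca ua].
  rewrite -(subrK a u) addrC.
  by apply: leq_trans (cnormD _ _) _; rewrite leq_add ?(hm y)// cnormB.
exists r, B; split => //; split.
  by move=> i; have [m hm] := bound i; exact: finite_set_patterns hm.
split.
  move=> i P BP; have [m hm] := bound i; split.
    by apply/finite_set_bounded; exists m => u; exact: hm.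
  by have [y [My y0 ->]] := BP; exact: cluster_is_cluster.
split.
  move=> i _ [y [My y0 ->]].
  have [m hm] := component_uniform_bound (r i.+1).
  have [n [c [G [cz glue EG]]]] := cluster_gluing (ltnW (rlt i)) y0 (hm y My).
  exists n, (fun k => cluster_at z (r i) (translate (c k) y) 0), (fun k => - c k), G.
  split => //.
    move=> k; exists (translate (c k) y); split => //; first exact: invM.
    by rewrite /translate add0r.
  rewrite (_ : (fun k => _) = fun k => cluster_at z (r i) y (c k)) //.
  by apply/funext => k; exact: cluster_translate.
split.
  move=> i _ _ [y [My y0 ->]] [w [Mw w0 ->]].
  have [_ + _] := hF (r i); move=> /(_ y w My Mw y0 w0)[g cg <-].
  exists (- g); rewrite cluster_translate.
  exact: cluster_subpattern (ltnW (rlt i)) cg.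
split.
  move=> i _ [y [My y0 ->]].
  have [_ _ /(_ y My y0)[g cg ncg]] := hF (r i).
  exists (cluster_at z (r i) y 0), (cluster_at z (r i) (translate g y) 0), 0, (- g).
  have -> : translate 0 (cluster_at z (r i) y 0) = cluster_at z (r i) y 0.
    by apply/funext => u; rewrite /translate addr0.
  rewrite cluster_translate; split.
  - split; first by exists y.
    exists (translate g y); split => //; first exact: invM.
    by rewrite /translate add0r; exact: component_nonzero cg.
  - by apply: cluster_subpattern (ltnW (rlt i)) _; exact: component_refl.
  - exact: cluster_subpattern (ltnW (rlt i)) cg.
  - rewrite !psupport_cluster; apply/seteqP; split=> // u [cu gu]; apply: ncg.
    by apply: (component_trans cu); exact: component_sym.
exists (fun=> 0), (fun j => cluster_at z (r j) x 0); split.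
  by move=> j; exists x.
(* once r j >= m, the nonzero cells within distance m are linked to the origin *)
move=> U /nbhs_agree[m mU].
exists m => // j /= mj; apply: mU => u um.
rewrite /translate addr0 /extend /cluster_at; case: ifPn => //= /negP nu.
apply/eqP; apply: contra_notT nu => xu; apply/mem_set/sub_fatten.
apply: linked_step => //; rewrite cell_distC -cnormB subr0.
by apply: leq_trans um _; apply: leq_trans mj _.
Qed.

End Fractal.

(** * Heights and tall cells *)

Lemma cell_dist_chain (c b d d' b' c' : cell) (N G m : nat) :
  (cell_dist c b <= N)%N -> (cell_dist d b <= G)%N ->
  (cell_dist d d' <= m)%N -> (cell_dist d' b' <= G)%N ->
  (cell_dist c' b' <= N)%N -> (cell_dist c c' <= 2 * (N + G) + m)%N.
Proof.
move=> cb db dd' d'b' c'b'.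
rewrite (_ : (2 * _ + _ = N + (G + (m + (G + N))))%N); last by clear; lia.
apply: leq_trans (cell_dist_triangle b _ _) (leq_add cb _).
rewrite cell_distC in db; apply: leq_trans (cell_dist_triangle d _ _) (leq_add db _).
apply: leq_trans (cell_dist_triangle d' _ _) (leq_add dd' _).
rewrite cell_distC in c'b'.
exact: leq_trans (cell_dist_triangle b' _ _) (leq_add d'b' c'b').
Qed.

(** Near the height of [c] the support is bounded, and it continues above and
    below [c] in steps of height between [w] and [2 * w].  The lower bound on
    the steps makes the ascent of the highway uniform; the factor 2 in the first
    condition puts the neighbours of [c] within distance [E]. *)
Definition tight_at (R : realType) (h : cell -> R) (S : finType) (z : S)
    (w : R) (E : nat) (x : config S) (c : cell) : Prop :=
  [/\ forall c', x c' != z -> `|h c - h c'| <= 2 * w -> (cell_dist c c' <= E)%N,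
      exists2 c', x c' != z & h c + w <= h c' <= h c + 2 * w
    & exists2 c', x c' != z & h c - 2 * w <= h c' <= h c - w].

(** In this part a height is any additive Lipschitz function on the cells. *)
Section Heights.
Variables (R : realType) (h : cell -> R) (C : R).
Hypothesis hB : forall u v : cell, h (u - v) = h u - h v.
Hypothesis C0 : 0 < C.
Hypothesis hC : forall u, `|h u| <= C * (cnorm u)%:R.

Lemma height0 : h 0 = 0.
Proof. by have := hB 0 0; rewrite !subrr. Qed.

Lemma heightD (u v : cell) : h (u + v) = h u + h v.
Proof. by rewrite -[v in LHS]opprK hB -[- v]sub0r hB height0 sub0r opprK. Qed.

Lemma height_lip u v n : (cell_dist u v <= n)%N -> `|h u - h v| <= C * n%:R.
Proof.
move=> uv; rewrite -hB; apply: le_trans (hC _) _.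
by rewrite ler_pM2l // ler_nat cnormB.
Qed.

Section Crossing.
Variables (r : nat) (w : R) (A : set cell).
Hypothesis rw : C * r%:R <= w.

(** A step changes the height by at most [w], so a path cannot jump over an
    interval of length [w]. *)
Lemma linked_crosses t u v : linked r A u v -> h u <= t + w -> t <= h v ->
  exists2 c, linked r A u c & t <= h c <= t + w.
Proof.
have rw' := rw; elim=> [a Aa|a b c Aa ab l IH] ha tv.
  by exists a; [exact: linked0 | rewrite tv].
have [ta|at_] := leP t (h a).
  by exists a; [exact: linked0 | rewrite ta].
have := height_lip ab; rewrite ler_norml => /andP[ab1 ab2].
have [|//|d bd td] := IH; first by lra.
by exists d => //; exact: linkedS ab bd.
Qed.

(** Stop the path just before it first exceeds [a'], and cut off everything up to
    its last visit to the heights below [a - w]. *)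
Lemma linked_crosses_slab a a' u v : a <= a' -> linked r A u v ->
  h u <= a -> a' <= h v ->
  exists c c', [/\ `|h c - a| <= w, `|h c' - a'| <= w
    & linked r (A `&` [set d | a - w <= h d <= a' + w]) c c'].
Proof.
move=> aa' l ua va'; have rw' := rw.
have w0 : 0 <= w by apply: le_trans rw; rewrite mulr_ge0 // ltW.
pose B := A `&` [set d | a - w <= h d <= a' + w].
(* the second case: the rest of the path stays in the slab until it reaches a' *)
suff : (exists c c', [/\ `|h c - a| <= w, `|h c' - a'| <= w & linked r B c c'])
    \/ (exists2 c', `|h c' - a'| <= w & linked r B u c').
  case=> // -[c' hc' l']; exists u, c'; split => //.
  by have [_ /= /andP[]] := linked_src l'; rewrite ler_norml; lra.
have {ua} : h u <= a' by lra.
elim: l va' => {u v} [u Au|u b v Au ub lbv IH] va' ua'.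
  right; exists u; first by rewrite ler_norml; lra.
  by apply: linked0; split => //=; lra.
have := height_lip ub; rewrite ler_norml => /andP[ub1 ub2].
have [ba'|ba'] := leP (h b) a'; last first.
  right; exists u; first by rewrite ler_norml; lra.
  by apply: linked0; split => //=; lra.
have [|[c' hc' lb]] := IH va' ba'; first by left.
have [au|ua] := leP (a - w) (h u).
  right; exists c' => //; apply: linkedS ub lb; split => //=; lra.
left; exists b, c'; split => //.
by have [_ /= /andP[]] := linked_src lb; rewrite ler_norml; lra.
Qed.

End Crossing.

Section TallCells.
Variables (S : finType) (z : S) (M : set (config S)).
Hypothesis minM : minimal_subshift z M.
Hypothesis stripM : forall x (H : R), M x ->
  finite_set (nonzero_cells z x `&` [set c | `|h c| <= H]).

(** A linked set of bounded height has bounded diameter, because slabs have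
    finite support in every configuration of [M]. *)
Lemma slab_bound r (H : R) : exists m, forall x c d, M x ->
  linked r (nonzero_cells z x `&` [set e | `|h e - h c| <= H]) c d ->
  (cell_dist c d <= m)%N.
Proof.
have [[cM invM _] _] := minM.
have [x Mx|m hm] := @linked_uniform_bound S z M [set e | `|h e| <= H] r cM.
  have /finite_set_bounded[m hm] := stripM H Mx.
  by exists m => v /linked_tgt/hm.
exists m => x c d Mx l; rewrite cell_distC -cnormB; apply: (hm _ (invM c _ Mx)).
rewrite -(subrr c); apply: linked_map l => // e [xe he]; split => /=.
  by rewrite /nonzero_cells /= /translate subrK.
by rewrite hB.
Qed.

Definition tall r (T : R) (x : config S) (c : cell) : Prop :=
  exists u v, [/\ component z r x c u, component z r x c v,
    h u <= h c - T & h c + T <= h v].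

Definition realizable (s : seq cell) : Prop :=
  exists2 x : config S, M x & forall u, u \in s -> x u != z.

Variables (r : nat) (w : R).
Hypothesis rw : C * r%:R <= w.

(** The premise says that tall cells may have nonzero cells far away at about
    the same height.  If [s] could not be enlarged, a copy of [s] would fill the
    support of its slab; see the copies [b + s] near [c] and [b' + s] near [c']
    below. *)
Lemma realizable_extend (W : R) (s : seq cell) :
  (forall (D : nat) (T : R), exists x c c', [/\ M x, tall r T x c, x c' != z,
     `|h c' - h c| <= W & (D < cell_dist c c')%N]) ->
  0 \in s -> (forall u, u \in s -> `|h u| <= w) -> realizable s ->
  exists c, [/\ c \notin s, `|h c| <= w & realizable (c :: s)].
Proof.
move=> wide s0 sw [y My ys]; apply: contrapT => noext.
have [[cM invM _] _] := minM.
have w0 : 0 <= w by apply: le_trans rw; rewrite mulr_ge0 // ltW.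
have /finite_set_bounded[G hG] : finite_set [set` s] by exact: finite_seq.
have [N hN] := syndetic G minM.
(* b is the position of a copy of s near c: nothing else is left in its slab *)
have bunch x c : M x -> x c != z -> exists2 b : cell, (cell_dist c b <= N)%N &
    forall u, x u != z -> `|h u - h b| <= w -> (cell_dist u b <= G)%N.
  move=> Mx xc; have [|g gN hg] := hN (translate c x) y (invM c _ Mx) My _ (ys 0 s0).
    by rewrite /translate add0r.
  exists (c + g).
    by rewrite cell_distC -cnormB addrAC subrr add0r.
  move=> u xu hu; rewrite -cnormB; apply: (hG) => /=.
  apply: contrapT => /negP us; apply: noext.
  exists (u - (c + g)); split => //; first by rewrite hB.
  exists (translate (c + g) x) => [|d]; first exact: invM.
  rewrite inE => /orP[/eqP ->|ds]; first by rewrite /translate subrK.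
  have := ys d ds; rewrite -hg; last exact: hG.
  by rewrite translateD (addrC g c).
pose H : R := 2 * C * N%:R + W + 2 * w.
have [m hm] := slab_bound r H.
have CN0 : 0 <= C * N%:R by rewrite mulr_ge0 // ltW.
have [x [c [c' [Mx tc xc' cc' far]]]] :=
  wide (2 * (N + G) + m)%N (C * N%:R + W + w).
have [u [v [cu cv hu hv]]] := tc.
have xc : x c != z by exact: linked_src cu.
have [b cb hb] := bunch x c Mx xc.
have [b' cb' hb'] := bunch x c' Mx xc'.
have uv : linked r (nonzero_cells z x) u v.
  by apply: linked_trans cv; exact: linked_sym.
(* u and v lie beyond the heights of b and b', so their path crosses both slabs *)
have close a a' : h u <= a -> a' <= h v -> a <= a' -> a' - a <= 2 * C * N%:R + W ->
    exists d d', [/\ x d != z, x d' != z, `|h d - a| <= w, `|h d' - a'| <= w &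
      (cell_dist d d' <= m)%N].
  move=> ua va' aa' aH.
  have [d [d' [hd hd' l]]] := linked_crosses_slab rw aa' uv ua va'.
  exists d, d'; split => //; first by have [] := linked_src l.
    by have [] := linked_tgt l.
  apply: (hm x) => //; apply: linked_sub l => // e [xe /= /andP[e1 e2]].
  split => //=; move: hd; rewrite !ler_norml /H; lra.
have h1 := height_lip cb; have h2 := height_lip cb'.
rewrite !ler_norml in h1 h2 cc'.
have tri d d' : (cell_dist d b <= G)%N -> (cell_dist d' b' <= G)%N ->
    (cell_dist d d' <= m)%N -> False.
  move=> db d'b' dd'; move: far; rewrite ltnNge => /negP; apply.
  exact: cell_dist_chain cb db dd' d'b' cb'.
have [bb'|b'b] := leP (h b) (h b').
  have [|||| d [d' [xd xd' hd hd' dd']]] := close (h b) (h b'); [lra..|].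
  by apply: (tri d d') => //; [exact: hb|exact: hb'].
have [|||| d [d' [xd xd' hd hd' dd']]] := close (h b') (h b); [lra..|].
by apply: (tri d' d); [exact: hb|exact: hb'|rewrite cell_distC].
Qed.

(** Otherwise [realizable_extend] builds an increasing sequence of realizable
    subsets of one slab, and by compactness a configuration with infinitely
    many nonzero cells in that slab. *)
Lemma tall_narrow (W : R) : exists (D : nat) (T : R), 0 <= T /\
  forall x c c', M x -> tall r T x c -> x c' != z -> `|h c' - h c| <= W ->
    (cell_dist c c' <= D)%N.
Proof.
have [[cM invM [x0 Mx0 x00]] _] := minM.
apply: contrapT => unbounded.
have wide (D : nat) (T : R) : exists x c c', [/\ M x, tall r T x c, x c' != z,
    `|h c' - h c| <= W & (D < cell_dist c c')%N].
  apply: contrapT => nw; apply: unbounded; exists D, (Num.max 0 T).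
  rewrite le_max lexx; split=> // x c c' Mx [a [b [ca cb ha hb]]] xc' cc'.
  have TT : T <= Num.max 0 T by rewrite le_max lexx orbT.
  rewrite leqNgt; apply/negP => far; apply: nw; exists x, c, c'; split => //.
  by exists a, b; split => //; lra.
have w0 : 0 <= w by apply: le_trans rw; rewrite mulr_ge0 // ltW.
pose good s := [/\ uniq s, 0 \in s, (forall u, u \in s -> `|h u| <= w) & realizable s].
have ext s : exists c, good s -> good (c :: s).
  have [gs|ng] := pselect (good s); last by exists 0.
  have [us s0 sw rs] := gs.
  have [c [cs hc rc]] := realizable_extend wide s0 sw rs.
  exists c => _; split => //=; first by rewrite cs.
    by rewrite inE s0 orbT.
  by move=> u; rewrite inE => /orP[/eqP ->|/sw].
have [f hf] := choice ext.
pose s n := iter n (fun l => f l :: l) [:: 0].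
have gs n : good (s n).
  elim: n => [|n IH]; last exact: hf.
  split => //.
    by move=> u; rewrite inE => /eqP ->; rewrite height0 normr0.
  by exists x0 => // u; rewrite inE => /eqP ->.
have smono n k u : (n <= k)%N -> u \in s n -> u \in s k.
  move=> nk un; rewrite -(subnK nk); elim: (k - n)%N => //= i IH.
  by rewrite inE IH orbT.
suff [x Mx xs] : exists2 x : config S, M x & forall n u, u \in s n -> x u != z.
  have /finite_seqP[t ht] := stripM w Mx.
  have st n : {subset s n <= t}.
    move=> u us; have [_ _ sw _] := gs n.
    have : (nonzero_cells z x `&` [set c | `|h c| <= w]) u.
      by split; [exact: xs us | exact: sw].
    by rewrite ht.
  have [us _ _ _] := gs (size t).
  have := uniq_leq_size us (st (size t)).
  have -> n : size (s n) = n.+1 by elim: n {us} => //= n ->.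
  by rewrite ltnn.
apply: contrapT => nox.
have [|x Mx|n hn] := compact_bound cM
  (P := fun n x => exists2 u, u \in s n & x u = z).
- by move=> n k x nk [u us xu]; exists u => //; exact: smono us.
- apply: contrapT => no; apply: nox; exists x => // n u us.
  apply/eqP => xu; apply: no; exists n, (cnorm u) => y _ xy.
  by exists u => //; rewrite -xy.
- have [_ _ _ [x Mx xs]] := gs n; have [u us xu] := hn x Mx.
  by have := xs u us; rewrite xu eqxx.
Qed.

Hypothesis w0 : 0 <= w.

(** The component has unbounded height, as its part of bounded height is finite;
    any of its cells at height about [L] or [- L] is then tall. *)
Lemma tall_exists (L : R) x : 0 <= L -> M x -> ~ finite_set (component z r x 0) ->
  exists2 y, M y & tall r L y 0.
Proof.
move=> L0 Mx infx; have [[_ invM _] _] := minM; have rw' := rw; have w0' := w0.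
have h0 := height0.
suff [c cx] : exists c, tall r L x c.
  have [u [v [cu cv hu hv]]] := cx.
  exists (translate c x); first exact: invM.
  by exists (u - c), (v - c); split;
    rewrite ?hB ?h0; [apply/component_translate; rewrite add0r subrK ..|lra|lra].
have [v v0 hv] : exists2 v, component z r x 0 v & 2 * L + w < `|h v|.
  apply: contrapT => no; apply: infx.
  apply: sub_finite_set (stripM (2 * L + w) Mx) => v v0.
  split; first exact: linked_tgt v0.
  by rewrite /= leNgt; apply/negP => hv; apply: no; exists v.
have l0 : linked r (nonzero_cells z x) 0 0 by apply: linked0; exact: linked_src v0.
have [hv0|hv0] := leP 0 (h v).
  rewrite ger0_norm // in hv.
  have [||c l0c hc] := linked_crosses rw (t := L) v0; [lra|lra|].
  move/andP: hc => [hc1 hc2]; exists c, 0, v; split; [| |lra|lra].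
    exact: linked_sym.
  by apply: linked_trans v0; exact: linked_sym.
rewrite ltr0_norm // in hv.
have [||c l0c hc] := linked_crosses rw (t := - L - w) (linked_sym v0).
- lra.
- lra.
move/andP: hc => [hc1 hc2]; exists c, v, 0; split; [| |lra|lra].
  exact: linked_sym.
by apply: linked_trans (linked_sym l0c) _; exact: linked_sym.
Qed.

Variables (D : nat) (T : R).
Hypothesis T0 : 0 <= T.
Hypothesis narrow : forall x c c', M x -> tall r T x c -> x c' != z ->
  `|h c' - h c| <= 3 * w -> (cell_dist c c' <= D)%N.

(** The component of the origin crosses every height near that of [c], and the
    cells where it does so are tall; comparing [c] and its neighbours with them
    gives the diameter bound and the neighbours above and below. *)
Lemma tall_tight (n : R) x c : M x -> tall r (T + n + 3 * w) x 0 ->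
  x c != z -> `|h c| <= n -> tight_at h z w (2 * D) x c.
Proof.
move=> Mx [u [v [cu cv hu hv]]] xc hc; have w0' := w0; have T0' := T0.
rewrite height0 ?sub0r ?add0r in hu hv.
have uv : linked r (nonzero_cells z x) u v.
  by apply: linked_trans cv; exact: linked_sym.
move: hc; rewrite ler_norml => /andP[hc1 hc2].
have cross t : h c - 2 * w <= t -> t <= h c + w ->
    exists d, [/\ tall r T x d, x d != z, t <= h d & h d <= t + w].
  move=> t1 t2.
  have [||d ud /andP[hd1 hd2]] := linked_crosses rw (t := t) uv.
  - lra.
  - lra.
  exists d; split => //; last exact: linked_tgt ud.
  exists u, v; split; [| |lra|lra].
    exact: linked_sym.
  by apply: linked_trans uv; exact: linked_sym.
split.
- move=> c' xc'; rewrite ler_norml => /andP[h1 h2].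
  have [||d [td xd d1 d2]] := cross (h c); [lra|lra|].
  apply: leq_trans (cell_dist_triangle d _ _) _.
  rewrite mul2n -addnn leq_add //; last first.
    by apply: (narrow Mx td xc'); rewrite ler_norml; lra.
  by rewrite cell_distC; apply: (narrow Mx td xc); rewrite ler_norml; lra.
- have [||d [td xd d1 d2]] := cross (h c + w); [lra|lra|].
  by exists d => //; apply/andP; split; lra.
- have [||d [td xd d1 d2]] := cross (h c - 2 * w); [lra|lra|].
  by exists d => //; apply/andP; split; lra.
Qed.

(** Tightness is visible in a window, since the neighbours above and below are
    at bounded distance by the first condition; hence the configurations of
    [tall_tight] have a limit that is tight at all its cells. *)
Lemma tight_exists x0 : M x0 -> ~ finite_set (component z r x0 0) ->
  exists y : config S, [/\ M y, y 0 != z &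
    forall c, y c != z -> tight_at h z w (2 * D) y c].
Proof.
move=> Mx0 infx0; have [[cM invM _] _] := minM; have w0' := w0; have T0' := T0.
pose good (n : nat) (x : config S) := x 0 != z /\
  forall c, x c != z -> `|h c| <= n%:R -> tight_at h z w (2 * D) x c.
suff [y My hy] : exists2 y, M y & forall n, good n y.
  exists y; split => //; first by have [] := hy 0%N.
  move=> c yc; have [_] := hy (Num.bound `|h c|); apply => //.
  by apply: ltW; apply: archi_boundP.
apply: contrapT => noy.
have [|x Mx|n hn] := compact_bound cM (P := fun n x => ~ good n x).
- move=> n k x nk ng [x00 hx]; apply: ng; split => // c xc hc; apply: hx => //.
  by apply: le_trans hc _; rewrite ler_nat.
- have [x00|x00] := eqVneq (x 0) z.
    exists 0%N, 0%N => y _ xy [y0 _].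
    by move: y0; rewrite -(xy 0) ?cnorm0// x00 eqxx.
  have [n [c [xc hc nt]]] : exists n c, [/\ x c != z, `|h c| <= (n : nat)%:R &
      ~ tight_at h z w (2 * D) x c].
    apply: contrapT => no; apply: noy; exists x => // n; split => // c xc hc.
    by apply: contrapT => nt; apply: no; exists n, c.
  have [[c' [xc' cc' far]]|near] :=
      pselect (exists c', [/\ x c' != z, `|h c - h c'| <= 2 * w &
        ~ (cell_dist c c' <= 2 * D)%N]).
    exists n, (cnorm c + cnorm c')%N => y _ xy [_ /(_ c)].
    rewrite -xy ?leq_addr // => /(_ xc hc)[/(_ c') + _ _].
    by rewrite -xy ?leq_addl // => /(_ xc' cc').
  exists n, (cnorm c + 2 * D)%N => y _ xy [_ /(_ c)].
  rewrite -xy ?leq_addr // => /(_ xc hc)[ty uy dy].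
  have win d : (cell_dist c d <= 2 * D)%N -> x d = y d.
    move=> cd; apply: xy; rewrite -(subrK c d) addrC.
    by apply: leq_trans (cnormD _ _) _; rewrite leq_add2l cnormB cell_distC.
  apply: nt; split.
  + move=> c' xc' cc'; apply: contrapT => far; apply: near; by exists c'.
  + have [d yd /andP[hd1 hd2]] := uy; exists d; last by rewrite hd1.
    by rewrite win //; apply: ty => //; rewrite ler_norml; lra.
  + have [d yd /andP[hd1 hd2]] := dy; exists d; last by rewrite hd1.
    by rewrite win //; apply: ty => //; rewrite ler_norml; lra.
- have n0 : 0 <= n%:R :> R by [].
  have [|x Mx tx] := @tall_exists (T + n%:R + 3 * w) x0 _ Mx0 infx0; first lra.
  apply: (hn x Mx); split => [|c xc hc]; last exact: tall_tight tx xc hc.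
  by have [u [_ [cu _ _ _]]] := tx; exact: linked_src cu.
Qed.

End TallCells.
End Heights.

(** * From tight configurations to highways *)

Section Highway.
Variables (R : realType) (h : cell -> R).
Hypothesis hB : forall u v : cell, h (u - v) = h u - h v.

(** Ties between cells of equal height are broken lexicographically: this is the
    positive cone of a total group order on the cells, which refines the height
    and is invariant under translation. *)
Definition above (d : cell) : bool :=
  (0 < h d) || (h d == 0) && ((0 < d.1) || (d.1 == 0) && (0 < d.2)).

Lemma above_ge0 d : above d -> 0 <= h d.
Proof. by case/orP => [/ltW//|/andP[/eqP -> _]]. Qed.

Lemma above_gt0 d : 0 < h d -> above d.
Proof. by move=> hd; rewrite /above hd. Qed.

Lemma above0 : above 0 = false.
Proof. by rewrite /above (height0 hB) ltxx eqxx. Qed.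

Lemma aboveD d e : above d -> above e -> above (d + e).
Proof.
rewrite /above (heightD hB); case: d e => [d1 d2] [e1 e2] /=.
move=> /orP[hd|/andP[/eqP hd dd]] /orP[he|/andP[/eqP he ee]].
- by rewrite addr_gt0.
- by rewrite he addr0 hd.
- by rewrite hd add0r he.
- by rewrite hd he addr0 eqxx ltxx /=; lia.
Qed.

Lemma aboveN d : above d -> ~~ above (- d).
Proof. by move=> ad; apply/negP => /(aboveD ad); rewrite subrr above0. Qed.

Lemma above_total d : d != 0 -> above d || above (- d).
Proof.
have -> : above (- d) = (h d < 0) ||
    (h d == 0) && ((d.1 < 0) || (d.1 == 0) && (d.2 < 0)).
  rewrite /above -[- d]sub0r hB (height0 hB) sub0r oppr_gt0 oppr_eq0.
  by case: d => [a b] /=; rewrite !sub0r !oppr_gt0 oppr_eq0.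
rewrite /above; case: ltgtP => //= _.
by case: d => [a b]; rewrite xpair_eqE /=; lia.
Qed.

Lemma lowest_exists (s : seq cell) : s != [::] ->
  exists2 d, d \in s & forall e, e \in s -> e = d \/ above (e - d).
Proof.
elim: s => // a s IH _; have [->|/IH[d ds hd]] := eqVneq s [::].
  by exists a; [rewrite inE | move=> e; rewrite inE => /eqP; left].
have [->|ad] := eqVneq a d.
  exists d; first by rewrite inE eqxx.
  by move=> e; rewrite inE => /orP[/eqP|/hd]; [left|].
have : a - d != 0 by rewrite subr_eq0.
move=> /above_total/orP[up|]; last rewrite opprB => dn.
  exists d; first by rewrite inE ds orbT.
  by move=> e; rewrite inE => /orP[/eqP ->|/hd]; [right|].
exists a; first by rewrite inE eqxx.
move=> e; rewrite inE => /orP[/eqP|/hd[->|ed]]; [by left|by right|right].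
have -> : e - a = (e - d) + (d - a) by rewrite addrA subrK.
exact: aboveD.
Qed.

Variables (S : finType) (z : S).
Variables (w : R) (E : nat) (y : config S).
Hypothesis w0 : 0 < w.
Hypothesis y0 : y 0 != z.
Hypothesis tight : forall c, y c != z -> tight_at h z w E y c.

(** [c + d] is the successor of [c] in the support for the order [above]; the
    definition only looks at differences, so that it commutes with shifts. *)
Definition next_step (c d : cell) : Prop :=
  [/\ y (c + d) != z, above d, (cnorm d <= E)%N
    & forall e, above e -> y (c + e) != z -> e = d \/ above (e - d)].

(** The cells between [c] and its neighbour above lie at most [2 * w] higher,
    hence within distance [E] of [c]: the successor is the lowest of finitely
    many candidates. *)
Lemma next_step_exists c : y c != z -> exists d, next_step c d.
Proof.
move=> yc; have [near [c' yc' /andP[c1 c2]] _] := tight yc; have w0' := w0.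
pose s := [seq d <- cells_within E | above d && (y (c + d) != z :> S)].
have d1s : c' - c \in s.
  rewrite mem_filter mem_cells_within cnormB [c + _]addrC subrK yc' andbT.
  rewrite above_gt0 ?hB; last lra.
  by rewrite cell_distC near // ler_norml; lra.
have [|d ds hd] := @lowest_exists s; first by case: (s) d1s.
have := ds; rewrite mem_filter mem_cells_within => /andP[/andP[ad yd] dE].
exists d; split => // e ae ye.
have hdw : h d <= 2 * w.
  have [<-|/above_ge0] := hd _ d1s; rewrite !hB; lra.
have [eE|eE] := boolP (e \in cells_within E).
  by apply: hd; rewrite mem_filter ae ye.
right; apply: above_gt0; rewrite hB.
have ge0 := above_ge0 ae.
rewrite mem_cells_within in eE; apply: contraNT eE; rewrite -leNgt => le.
have := near (c + e) ye; rewrite cell_distC -cnormB [c + e]addrC addrK; apply.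
by rewrite (heightD hB) ler_norml; lra.
Qed.

Lemma next_step_unique c d e : next_step c d -> next_step c e -> d = e.
Proof.
move=> [yd ad _ hd] [ye ae _ he].
have [//|de] := he d ad yd; have [//|ed] := hd e ae ye.
by move: (aboveN de); rewrite opprB ed.
Qed.

Lemma next_step_agree c c' d : y c' != z ->
  agree E (translate c y) (translate c' y) -> next_step c d -> next_step c' d.
Proof.
move=> yc' cc' nd; have [e ne] := next_step_exists yc'.
have [yd ad dE hd] := nd; have [ye ae eE he] := ne.
have yd' : y (c' + d) != z by have := cc' d dE; rewrite /translate ![d + _]addrC => <-.
have ye' : y (c + e) != z by have := cc' e eE; rewrite /translate ![e + _]addrC => ->.
have [-> //|de] := he d ad yd'; have [<- //|ed] := hd e ae ye'.
by move: (aboveN de); rewrite opprB ed.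
Qed.

Variable step : cell -> cell.
Hypothesis stepP : forall c, y c != z -> next_step c (step c).

Definition next_cell (c : cell) : cell := c + step c.

Lemma next_nonzero c : y c != z -> y (next_cell c) != z.
Proof. by move=> /stepP[]. Qed.

Lemma iter_next_nonzero n c : y c != z -> y (iter n next_cell c) != z.
Proof. by move=> yc; elim: n => //= n; exact: next_nonzero. Qed.

Lemma next_above c : y c != z -> above (next_cell c - c).
Proof. by move=> /stepP[_ + _ _]; rewrite /next_cell addrAC subrr add0r. Qed.

Lemma iter_next_above m n c : y c != z -> (m < n)%N ->
  above (iter n next_cell c - iter m next_cell c).
Proof.
move=> yc; elim: n => // n IH; rewrite ltnS leq_eqVlt => /orP[/eqP ->|/IH mn].
  by apply: next_above; exact: iter_next_nonzero.
rewrite -(subrK (iter n next_cell c) (iter n.+1 next_cell c)) -addrA aboveD //.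
by apply: next_above; exact: iter_next_nonzero.
Qed.

Lemma next_least c c' : y c != z -> y c' != z -> above (c' - c) ->
  c' = next_cell c \/ above (c' - next_cell c).
Proof.
move=> yc yc' cc'; have [_ _ _ /(_ _ cc')] := stepP yc.
rewrite addrC subrK => /(_ yc')[e|e]; [left|right].
  by rewrite /next_cell -e addrC subrK.
by rewrite /next_cell opprD addrA.
Qed.

Lemma iter_next_height_le m n c : y c != z -> (m <= n)%N ->
  h (iter m next_cell c) <= h (iter n next_cell c).
Proof.
move=> yc; rewrite leq_eqVlt => /orP[/eqP ->//|mn].
by have := above_ge0 (iter_next_above yc mn); rewrite hB subr_ge0.
Qed.

(** More successors than this cannot stay within height [2 * w] of a cell, as
    they would be distinct cells within distance [E] of it. *)
Definition lap : nat := size (cells_within E).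

Lemma iter_next_lap c : y c != z -> h c + 2 * w < h (iter lap next_cell c).
Proof.
move=> yc; rewrite ltNge; apply/negP => le.
pose s := [seq iter i next_cell c - c | i <- iota 0 lap.+1].
have us : uniq s.
  rewrite map_inj_in_uniq ?iota_uniq // => i j _ _ /addIr ij.
  apply/eqP; apply: contraT; rewrite neq_ltn => /orP[] /(iter_next_above yc).
    by rewrite ij subrr above0.
  by rewrite ij subrr above0.
have sub : {subset s <= cells_within E}.
  move=> _ /mapP[i + ->]; rewrite mem_iota add0n ltnS => /= il.
  rewrite mem_cells_within cnormB cell_distC.
  have [near _ _] := tight yc; apply: near; first exact: iter_next_nonzero.
  have h1 := iter_next_height_le yc (leq0n i).
  have h2 := iter_next_height_le yc il.
  by rewrite /= in h1; rewrite ler_norml; lra.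
by have := uniq_leq_size us sub; rewrite size_map size_iota ltnn.
Qed.

Lemma iter_next_laps n c : y c != z ->
  h c + 2 * w * n%:R <= h (iter (lap * n) next_cell c).
Proof.
move=> yc; elim: n => [|n IH]; first by rewrite muln0 mulr0 addr0.
rewrite mulnS iterD -natr1.
have := iter_next_lap (iter_next_nonzero (lap * n) yc).
by move: IH; lra.
Qed.

(** No cell of the support is skipped by the successor, and the heights of the
    iterated successors tend to infinity. *)
Lemma next_reaches c c' : y c != z -> y c' != z -> above (c' - c) ->
  exists n, iter n next_cell c = c'.
Proof.
move=> yc yc' cc'; apply: contrapT => no.
have below n : above (c' - iter n next_cell c).
  elim: n => //= n IH.
  have [e|//] := next_least (iter_next_nonzero n yc) yc' IH.
  by exfalso; apply: no; exists n.+1.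
pose n := Num.bound ((h c' - h c) / (2 * w)).
have h1 : 0 <= h c' - h c by rewrite -hB above_ge0.
have : (h c' - h c) / (2 * w) < n%:R.
  by apply: archi_boundP; rewrite divr_ge0 // mulr_ge0 // ltW.
rewrite ltr_pdivrMr; last by rewrite mulr_gt0.
have := iter_next_laps n yc.
have := above_ge0 (below (lap * n)%N); rewrite hB.
lra.
Qed.

Lemma next_inj c c' : y c != z -> y c' != z ->
  next_cell c = next_cell c' -> c = c'.
Proof.
move=> yc yc' e; apply/eqP; apply: contraT => cc'.
have : c - c' != 0 by rewrite subr_eq0.
have key a b : y a != z -> y b != z -> next_cell a = next_cell b -> above (b - a) -> False.
  move=> ya yb ab ba; have := next_above yb; rewrite -ab => nb.
  have [e'|] := next_least ya yb ba; first by move: nb; rewrite -e' subrr above0.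
  by move=> /aboveN; rewrite opprB nb.
by move=> /above_total/orP[|]; [|rewrite opprB] => /key; [case/(_ _ _ (esym e))|case].
Qed.

Lemma iter_next_inj n c c' : y c != z -> y c' != z ->
  iter n next_cell c = iter n next_cell c' -> c = c'.
Proof.
move=> yc yc'; elim: n => //= n IH /next_inj e.
by apply/IH/e; exact: iter_next_nonzero.
Qed.

Lemma prev_exists c : y c != z -> exists2 e, y e != z & next_cell e = c.
Proof.
move=> yc; have [_ _ [e ye /andP[e1 e2]]] := tight yc; have w0' := w0.
have ec : above (c - e) by apply: above_gt0; rewrite hB; lra.
have [[|n] en] := next_reaches ye yc ec.
  by move: ec; rewrite -en subrr above0.
by exists (iter n next_cell e) => //; exact: iter_next_nonzero.
Qed.

Variable prev_cell : cell -> cell.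
Hypothesis prevP : forall c, y c != z ->
  y (prev_cell c) != z /\ next_cell (prev_cell c) = c.

Definition road (i : int) : cell :=
  match i with Posz n => iter n next_cell 0 | Negz n => iter n.+1 prev_cell 0 end.

Lemma iter_prev_nonzero n : y (iter n prev_cell 0) != z.
Proof. by elim: n => //= n /prevP[]. Qed.

Lemma road_nonzero i : y (road i) != z.
Proof. by case: i => n; [exact: iter_next_nonzero|exact: iter_prev_nonzero]. Qed.

Lemma road_next i : road (i + 1) = next_cell (road i).
Proof.
case: i => [n|[|n]].
- by rewrite -PoszD addn1.
- by have [_ ->] := prevP y0.
- rewrite (_ : Negz n.+1 + 1 = Negz n); last first.
    by rewrite !NegzE -[n.+2]addn1 PoszD opprD addrNK.
  by have [_ /= ->] := prevP (iter_prev_nonzero n.+1).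
Qed.

Lemma road_iter i n : road (i + n%:Z) = iter n next_cell (road i).
Proof.
elim: n => [|n IH]; first by rewrite addr0.
by rewrite -addn1 PoszD addrA road_next IH addn1.
Qed.

Lemma road_range : nonzero_cells z y = range road.
Proof.
apply/seteqP; split=> [c yc|_ [i _ <-]]; last exact: road_nonzero.
have [->|c0] := eqVneq c 0; first by exists 0.
have /above_total/orP[] := c0.
  rewrite -[c in above c]subr0 => ac.
  by have [n <-] := next_reaches y0 yc ac; exists n%:Z.
rewrite -sub0r => ac; have [n en] := next_reaches yc y0 ac.
exists (- n%:Z) => //.
apply: (@iter_next_inj n) => //; first exact: road_nonzero.
by rewrite -road_iter addNr en.
Qed.


Lemma lap_gt0 : (0 < lap)%N.
Proof.
have : 0 \in cells_within E by rewrite mem_cells_within cnorm0.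
by rewrite /lap; case: cells_within.
Qed.

Lemma road_climbs (n q : nat) (i : int) : (lap * n <= q)%N ->
  h (road i) + 2 * w * n%:R <= h (road (i + q%:Z)).
Proof.
move=> nq; rewrite road_iter; apply: le_trans (iter_next_laps n (road_nonzero i)) _.
exact: iter_next_height_le (road_nonzero i) nq.
Qed.

(** Since the successor is determined by the window of radius [E], the next [n]
    steps of the road are determined by the window of radius [n * E]. *)
Lemma road_agree n i k :
  agree (n * E) (translate (road k) y) (translate (road i) y) ->
  forall t, (t <= n)%N -> (cnorm (road (i + t%:Z) - road i) <= t * E)%N /\
    road (k + t%:Z) - road k = road (i + t%:Z) - road i.
Proof.
move=> ag; elim=> [|t IH] tn; first by rewrite !addr0 !subrr cnorm0.
have [tE eq] := IH (ltnW tn).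
have stepE j : road (j + t.+1%:Z) = road (j + t%:Z) + step (road (j + t%:Z)).
  by rewrite -addn1 PoszD addrA road_next.
have [_ _ sE _] := stepP (road_nonzero (i + t%:Z)).
have -> : road (i + t.+1%:Z) - road i =
    (road (i + t%:Z) - road i) + step (road (i + t%:Z)).
  by rewrite stepE addrAC.
split; first by apply: leq_trans (cnormD _ _) _; rewrite mulSn addnC leq_add.
have -> : step (road (i + t%:Z)) = step (road (k + t%:Z)).
  apply: next_step_unique (stepP (road_nonzero (i + t%:Z))) _.
  apply: next_step_agree (stepP (road_nonzero (k + t%:Z))).
    exact: road_nonzero.
  rewrite -(subrK (road k) (road (k + t%:Z))) -(subrK (road i) (road (i + t%:Z))).
  rewrite eq -(translateD y _ (road k)) -(translateD y _ (road i)).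
  apply: agree_translate; apply: (agree_le _ ag).
  by apply: (@leq_trans (t.+1 * E)); rewrite ?mulSn ?leq_add2l // -mulSn leq_mul2r tn orbT.
by rewrite stepE addrAC eq.
Qed.

Variables (C : R) (M : set (config S)).
Hypothesis C0 : 0 < C.
Hypothesis hC : forall u, `|h u| <= C * (cnorm u)%:R.
Hypothesis minM : minimal_subshift z M.
Hypothesis My : M y.

(** [syndetic] finds the window of [road i] around some cell [road k] at bounded
    distance from a prescribed cell; the uniform ascent turns this into a bound
    on indices.  As recurrence asks for an index after [j], the search starts
    [Q] steps later, where [Q] exceeds that bound. *)
Lemma road_recurrent :
  uniformly_recurrent (fun i => (road (i + 1) - road i, (y (road i) : S))).
Proof.
move=> i n; have [[cM invM _] _] := minM.
have [N hN] := syndetic (n * E)%N minM.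
pose T := Num.bound (C * N%:R / (2 * w)).
have hT : C * N%:R < 2 * w * T%:R.
  have : C * N%:R / (2 * w) < T%:R.
    by apply: archi_boundP; rewrite divr_ge0 // mulr_ge0 // ltW.
  by rewrite ltr_pdivrMr ?mulr_gt0 // [T%:R * _]mulrC.
pose Q := (lap * T)%N.
exists (2 * Q)%N => j; set j' := j + Q%:Z.
have [||g gN ag] := hN _ _ (invM (road j') _ My) (invM (road i) _ My).
- by rewrite /translate add0r; exact: road_nonzero.
- by rewrite /translate add0r; exact: road_nonzero.
rewrite translateD in ag.
have : nonzero_cells z y (g + road j').
  have := ag 0; rewrite cnorm0 /translate !add0r /nonzero_cells /= => -> //.
  exact: road_nonzero.
rewrite road_range => -[k _ ek]; rewrite -ek in ag.
have hk : `|h (road k) - h (road j')| <= C * N%:R.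
  by apply: (height_lip hB C0 hC); rewrite ek -cnormB addrK.
move: hk; rewrite ler_norml => /andP[k1 k2].
have jk : j <= k.
  rewrite leNgt; apply/negP => kj.
  have := @road_climbs T `|j' - k|%N k; rewrite /j'.
  have -> : k + (`|(j + Q%:Z - k)%R|%N)%:Z = j + Q%:Z by lia.
  rewrite -/j' => /(_ _); have : (lap * T <= `|(j + Q%:Z - k)%R|)%N by rewrite /Q; lia.
  by move=> l /(_ l); lra.
have kj : k <= j + (2 * Q)%N%:Z.
  rewrite leNgt; apply/negP => jk'.
  have := @road_climbs T `|k - j'|%N j'; rewrite /j'.
  have -> : j + Q%:Z + (`|(k - (j + Q%:Z))%R|%N)%:Z = k by lia.
  rewrite -/j' => /(_ _); have : (lap * T <= `|(k - (j + Q%:Z))%R|)%N by rewrite /Q; lia.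
  by move=> l /(_ l); lra.
exists `|k - j|%N; first by lia.
have -> : j + (`|(k - j)%R|%N)%:Z = k by lia.
move=> t tn.
have follow := road_agree ag.
have [_ e1] := follow t (ltnW tn); have [_ e2] := follow t.+1 tn.
have e3 j0 : j0 + t%:Z + 1 = j0 + t.+1%:Z by lia.
rewrite !e3; congr pair.
  have step2 (a b c : cell) : a - b = (a - c) - (b - c).
    by rewrite opprB addrA subrK.
  by rewrite (step2 _ _ (road k)) e1 e2 -step2.
have [te _] := follow t (ltnW tn).
have := ag (road (i + t%:Z) - road i).
rewrite -{2}e1 /translate !subrK => ->  //.
by apply: leq_trans te _; rewrite leq_mul2r (ltnW tn) orbT.
Qed.

End Highway.

Lemma tight_highway (R : realType) (h : cell -> R) (C : R) (S : finType) (z : S)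
    (M : set (config S)) (w : R) (E : nat) (y : config S) :
  (forall u v : cell, h (u - v) = h u - h v) -> 0 < C ->
  (forall u, `|h u| <= C * (cnorm u)%:R) -> minimal_subshift z M -> M y ->
  y 0 != z -> 0 < w -> (forall c, y c != z -> tight_at h z w E y c) ->
  exists p : int -> cell,
    [/\ nonzero_cells z y = range p,
        exists B : nat, forall n : int, (cell_dist (p (n + 1)%R) (p n) <= B)%N,
        uniformly_ascending (fun n => h (p n))
      & uniformly_recurrent (fun i => (p (i + 1) - p i, (y (p i) : S)))].
Proof.
move=> hB C0 hC minM My y0 w0 tight.
have /choice[step stepP] : forall c, exists d, y c != z -> next_step h z E y c d.
  move=> c; have [yc|] := boolP (y c != z); last by exists 0.
  by have [d hd] := next_step_exists hB w0 tight yc; exists d.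
have /choice[prev prevP] : forall c, exists e, y c != z ->
    y e != z /\ next_cell step e = c.
  move=> c; have [yc|] := boolP (y c != z); last by exists 0.
  by have [e ye ec] := prev_exists hB w0 tight stepP yc; exists e.
exists (road step prev); split.
- exact: (road_range hB w0 y0 tight stepP prevP).
- exists E => n; rewrite (road_next y0 prevP) -cnormB.
  have [_ _ + _] := stepP _ (road_nonzero y0 stepP prevP n).
  by rewrite /next_cell addrAC subrr add0r.
- exists (lap E).-1 => j.
  rewrite prednK ?lap_gt0 // subr_gt0 (road_iter y0 prevP).
  have := iter_next_lap hB tight stepP (road_nonzero y0 stepP prevP j).
  by move: w0; lra.
- exact: (road_recurrent hB w0 y0 tight stepP prevP C0 hC minM My).
Qed.

(** * Strips of the plane and slabs of bounded height *)

Section Plane.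
Variables (R : realType) (v vT : R * R).
Hypothesis v0 : v <> (0, 0).
Hypothesis vvT : dot v vT = 0.
Hypothesis norm_vT : enorm vT = enorm v.

Definition height (c : cell) : R := dot (cellR R c) vT.

Lemma heightB (c d : cell) : height (c - d) = height c - height d.
Proof. by rewrite /height /dot /cellR /= !raddfB /=; ring. Qed.

(** The final 1 makes this Lipschitz constant positive without a discussion of
    [vT]. *)
Definition slope : R := `|vT.1| + `|vT.2| + 1.

Lemma slope_gt0 : 0 < slope.
Proof. by rewrite /slope ltr_wpDl // addr_ge0. Qed.

Lemma height_le (c : cell) : `|height c| <= slope * (cnorm c)%:R.
Proof.
have coord (a : int) : (`|a| <= cnorm c)%N -> `|a%:~R : R| <= (cnorm c)%:R.
  by move=> ac; rewrite -intr_norm -abszE -pmulrn ler_nat.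
have c1 : `|(c.1)%:~R : R| <= (cnorm c)%:R.
  by apply: coord; rewrite /cnorm /cell_dist subr0 leq_maxl.
have c2 : `|(c.2)%:~R : R| <= (cnorm c)%:R.
  by apply: coord; rewrite /cnorm /cell_dist !subr0 leq_maxr.
rewrite /height /dot /slope /=; apply: le_trans (ler_normD _ _) _.
rewrite !normrM !mulrDl mul1r ler_wpDr // lerD //.
  by rewrite mulrC ler_wpM2l.
by rewrite mulrC ler_wpM2l.
Qed.

Lemma dot_gt0 : 0 < dot v v.
Proof.
rewrite lt_def addr_ge0 ?sqr_ge0 ?andbT // -?expr2 ?sqr_ge0 //.
apply/eqP => /eqP; rewrite /dot -!expr2 paddr_eq0 ?sqr_ge0 // !sqrf_eq0.
by move=> /andP[/eqP e1 /eqP e2]; apply: v0; rewrite [v]surjective_pairing e1 e2.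
Qed.

Lemma dot_vT : dot vT vT = dot v v.
Proof.
have ge0 (u : R * R) : 0 <= dot u u by rewrite /dot addr_ge0 // -expr2 sqr_ge0.
by rewrite -(sqr_sqrtr (ge0 vT)) -(sqr_sqrtr (ge0 v)) -!/(enorm _) norm_vT.
Qed.

(** In the orthogonal basis formed by [v] and [vT], the component of [q - u]
    along [vT] is short; it serves as the vector of the ball. *)
Lemma strip_of_height (r : R) (u q : R * R) :
  `|dot q vT - dot u vT| <= r * enorm v -> strip v r u q.
Proof.
have n0 := dot_gt0; have e2 := dot_vT; have e1 := vvT.
have ev : 0 < enorm v by rewrite sqrtr_gt0.
have sv : enorm v ^+ 2 = dot v v by rewrite sqr_sqrtr // ltW.
have nn : dot v v != 0 by rewrite gt_eqF.
move=> hq; pose k := (dot q vT - dot u vT) / dot v v.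
exists (((q.1 - u.1) * v.1 + (q.2 - u.2) * v.2) / dot v v), (k * vT.1, k * vT.2).
split.
  have -> : enorm (k * vT.1, k * vT.2) = `|k| * enorm v.
    rewrite -norm_vT /enorm /dot /= -sqrtr_sqr -sqrtrM ?sqr_ge0 //.
    by congr Num.sqrt; ring.
  rewrite /k normrM normfV (gtr0_norm n0) mulrAC ler_pdivrMr // -sv expr2.
  by rewrite mulrA ler_pM2r.
rewrite [q in LHS]surjective_pairing.
move: e1 e2 nn; rewrite /k /dot /= {hq k n0 ev sv}.
move: (v.1) (v.2) (vT.1) (vT.2) (q.1) (q.2) (u.1) (u.2).
move=> a b c d q1 q2 u1 u2 e1 e2 nn.
have ac : a * c = - (b * d) by apply/eqP; rewrite -addr_eq0 e1.
have cc : c * c = b * b.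
  apply: (mulfI nn); transitivity ((a * c) * (a * c) + b * b * (c * c)); first by ring.
  rewrite ac; transitivity (b * b * (c * c + d * d)); first by ring.
  by rewrite e2; ring.
have dd : d * d = a * a by apply: (addrI (c * c)); rewrite e2 cc addrC.
have cd : c * d = - (a * b).
  apply: (mulfI nn).
  transitivity ((a * c) * (a * d) + (b * d) * (b * c)); first by ring.
  have -> : a * c * (a * d) = - (b * d) * (a * d) by rewrite ac.
  have -> : b * d * (b * c) = - (a * c) * (b * c) by rewrite ac opprK.
  transitivity (- (a * b * (c * c + d * d))); first by ring.
  by rewrite e2; ring.
congr pair.
- transitivity (u1 + ((q1 - u1) * (a * a + c * c) + (q2 - u2) * (a * b + c * d))
      / (a * a + b * b)); last by field.
  by rewrite cd cc; field.
- transitivity (u2 + ((q1 - u1) * (a * b + c * d) + (q2 - u2) * (b * b + d * d))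
      / (a * a + b * b)); last by field.
  by rewrite cd dd; field.
Qed.

Variables (S : finType) (z : S) (x : config S) (r : R).
Hypothesis r0 : 0 < r.
Hypothesis thin : forall u : R * R,
  finite_set (nonzero_cells z x `&` [set c | strip v r u (cellR R c)]).

(** A slab of any height is covered by finitely many of the strips of the
    hypothesis. *)
Lemma finite_slab (H : R) :
  finite_set (nonzero_cells z x `&` [set c | `|height c| <= H]).
Proof.
have rho0 : 0 < r * enorm v by rewrite mulr_gt0 // sqrtr_gt0 dot_gt0.
set rho := r * enorm v in rho0 *.
have one (s : R) : finite_set (nonzero_cells z x `&` [set c | `|height c - s| <= rho]).
  have us : dot (s / dot v v * vT.1, s / dot v v * vT.2) vT = s.
    transitivity (s / dot v v * dot vT vT); first by rewrite /dot /=; ring.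
    by rewrite dot_vT divfK // gt_eqF // dot_gt0.
  apply: sub_finite_set (thin (s / dot v v * vT.1, s / dot v v * vT.2)).
  move=> c [xc hc]; split => //=; apply: strip_of_height.
  by rewrite us.
have all n : finite_set (nonzero_cells z x `&` [set c | `|height c| <= n%:R * rho]).
  elim: n => [|n IH].
    apply: sub_finite_set (one 0) => c [xc /= hc]; split => //=.
    by rewrite subr0 (le_trans hc) // mul0r ltW.
  have fin3 : finite_set (
      (nonzero_cells z x `&` [set c | `|height c| <= n%:R * rho]) `|`
      ((nonzero_cells z x `&` [set c | `|height c - n.+1%:R * rho| <= rho]) `|`
       (nonzero_cells z x `&` [set c | `|height c - - (n.+1%:R * rho)| <= rho]))).
    by rewrite !finite_setU.
  apply: sub_finite_set fin3 => c [xc /=]; rewrite -natr1 mulrDl mul1r.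
  have [hn|hn] := leP (`|height c|) (n%:R * rho); first by left.
  move=> hn1; right; move: hn hn1.
  have [h0|h0] := leP 0 (height c).
    rewrite ger0_norm // => h1 h2; left; split => //=.
    by rewrite ler_norml; lra.
  rewrite ltr0_norm // => h1 h2; right; split => //=.
  by rewrite ler_norml; lra.
apply: sub_finite_set (all (Num.bound (`|H| / rho))) => c [xc /= hc]; split => //=.
apply: le_trans hc _; apply: le_trans (ler_norm _) _.
rewrite -ler_pdivrMr //; apply/ltW/archi_boundP.
by rewrite divr_ge0 // ltW.
Qed.

End Plane.

(** * The trichotomy *)

Theorem proposition6p18 (R : realType) (S : finType) (z : S)
    (X : set (config S)) (v vT : R * R) (r : R)
    (hX : subshift X) (hX0 : X <> [set zero_config z])
    (hv : v <> (0, 0))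
    (hvT : dot v vT = 0 /\ enorm vT = enorm v)
    (hr : 0 < r)
    (hstrip : forall (u : R * R) (x : config S), X x ->
       finite_set (nonzero_cells z x `&` [set c | strip v r u (cellR R c)])) :
  exists2 x : config S, X x &
    [\/ finite_point z x /\ x <> zero_config z,
        cluster_fractal z x
      | highway z vT x].
Proof.
have [[X0 cX invX] [vvT nvT]] := (hX, hvT).
have nX : nonzero_subshift z X.
  split => //.
  have [x Xx [u xu]] : exists2 x : config S, X x & exists u, x u != z.
    apply: contrapT => no; apply: hX0.
    have all0 x : X x -> x = zero_config z.
      move=> Xx; apply/funext => u; apply/eqP; apply: contrapT => /negP xu.
      by apply: no; exists x => //; exists u.
    apply/seteqP; split=> x; first exact: all0.
    by move=> ->; have [y Xy] := X0; rewrite -(all0 y Xy).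
  by exists (translate u x); [exact: invX | rewrite /translate add0r].
have [M MX minM] := minimal_subshift_exists nX.
have [[cM invM [x0 Mx0 x00]] _] := minM.
have [[x [Mx xz fx]]|infM] := pselect (exists x : config S,
    [/\ M x, x 0 != z & finite_set (nonzero_cells z x)]).
  exists x; first exact: MX.
  by apply: Or31; split => // ex; move: xz; rewrite ex eqxx.
have [allfin|] := pselect (forall k x, M x -> finite_set (component z k x 0)).
  exists x0; first exact: MX.
  apply: Or32; apply: (cluster_fractal_of_components minM) => // x Mx xz fx.
  by apply: infM; exists x.
move=> /existsNP[k /existsNP[x /not_implyP[Mx infx]]].
have stripM y (H : R) : M y ->
    finite_set (nonzero_cells z y `&` [set c | `|height vT c| <= H]).
  by move=> My; apply: (finite_slab hv vvT nvT hr) => u; exact/hstrip/MX.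
have hB := @heightB R vT; have C0 := slope_gt0 vT; have hC := @height_le R vT.
(* at least the height of one step at scale k, and positive also when k = 0 *)
pose w := slope vT * k.+1%:R.
have w0 : 0 < w by rewrite mulr_gt0.
have kw : slope vT * k%:R <= w by rewrite ler_pM2l // ler_nat.
have [D [T [T0 narrow]]] := tall_narrow hB C0 hC minM stripM kw (3 * w).
have [y [My y0 tight]] :=
  tight_exists hB C0 hC minM stripM kw (ltW w0) T0 narrow Mx infx.
exists y; first exact: MX.
apply: Or33.
have [p [range_p [B hp] asc_p rec_p]] :=
  tight_highway hB C0 hC minM My y0 w0 tight.
by exists p; split => //; exists B => n; rewrite PoszD; exact: hp.
Qed.
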